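(* Let $s \ge 6$ be an integer and let $\mu_1, \ldots, \mu_s$ be real numbers with $\mu_1$ irrational. Put $F(x_1,\ldots,x_s) = (x_1-\mu_1)^3 + \cdots + (x_s-\mu_s)^3$. Then the set $F(\mathbb{Z}^s) = \{F(\mathbf{x}) : \mathbf{x} \in \mathbb{Z}^s\}$ is dense in $\mathbb{R}$. *)

(* Defs.v *)
From HB Require Import structures.
From mathcomp Require Export all_boot all_order all_algebra.
From mathcomp Require Export classical_sets reals topology normedtype.

Set Implicit Arguments.
Unset Strict Implicit.
Unset Printing Implicit Defensive.

Import Order.TTheory GRing.Theory Num.Theory.

Local Open Scope ring_scope.

Definition shifted_cubes (R : realType) (s : nat) (mu : 'I_s -> R)
    (x : 'I_s -> int) : R :=
  \sum_(i < s) ((x i)%:~R - mu i) ^+ 3.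

(* Main.v *)
Require Import Defs.
From mathcomp Require Import all_boot all_order all_algebra.
From mathcomp Require Import boolp classical_sets reals topology normedtype.
From mathcomp Require Import ring lra.
Import numFieldNormedType.Exports.
Set Implicit Arguments.
Unset Strict Implicit.
Unset Printing Implicit Defensive.
Import Order.TTheory GRing.Theory Num.Theory.
Local Open Scope ring_scope.
Local Open Scope classical_set_scope.

(** Fixing [c = A + B], a pair of cubes [(A + t) ^ 3 + (B - t) ^ 3] is
    [3 c (t + (A - B) / 2) ^ 2 + c ^ 3 / 4], so six cubes contain an inhomogeneous
    diagonal ternary quadratic form [q], and the irrationality allows us to choose
    [c1 < 0 < c2, c3] with [c2 / c1] and [c3 / c1] irrational.

    If [q] takes arbitrarily small positive values [q v] at integer points, its
    inhomogeneous values are dense: on a line in direction [v] the form is a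
    slowly varying quadratic polynomial, and its slope at the crossing of the
    level [tau] is governed by an indefinite binary form of small discriminant,
    which is in turn made small by a second crossing argument.

    So suppose that [q] has no value in [(0, m)]. Small nonpositive values are
    excluded by a crossing argument as well, hence [|q| >= m] on nonzero integer
    points. This is the compact case of Margulis' theorem. Write [q] as
    [2 x z + y ^ 2] in a frame (a real basis), and let [unip t] be the unipotent
    one-parameter group of this form. All frames occurring below have reduced
    bases in a fixed compact set. If forms with the same gap accumulate at the
    form of a frame, then they drift apart polynomially under [unip t], in the
    direction of the square of the last coordinate. In the limit one obtains a
    frame on which [2 x z + y ^ 2 + b z ^ 2] has the gap for a fine chain of
    parameters [b], and some value must cross zero along this chain. If the
    accumulation takes place along this very direction, two returns of the
    unipotent orbit give an affine map close to the identity acting on the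
    admissible [b], with the same conclusion. Hence forms with a gap are isolated,
    so the returns of the orbit of [q] come from integral automorphs of [q]; by
    irrationality these fix the first coordinate axis up to sign, although the
    unipotent orbit of this axis is unbounded. *)

(** * Crossing and reduction of binary forms *)

Section Basics.
Variable R : realType.
Implicit Types x y : R.

(** A minimum need not be attained, so reduction works with near-minimisers; the factor [15 / 16] is
    close enough to one for the inequalities of the reduction arguments. *)
Lemma near_inf (T : Type) (P : T -> Prop) (F : T -> R) (l : R) :
  0 < l -> (exists t, P t) -> (forall t, P t -> l <= F t) ->
  exists2 t, P t & forall t', P t' -> 15 / 16 * F t <= F t'.
Proof.
move=> l0 [t0 Pt0] lF.
pose E := [set F t | t in [set t | P t]].
have Ein : has_inf E.
  split; first by exists (F t0), t0.
  by exists l => _ [t Pt <-]; apply: lF.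
have linf : l <= inf E.
  by apply: lb_le_inf; [exists (F t0), t0 | move=> _ [t Pt <-]; apply: lF].
have e0 : 0 < inf E / 15 by lra.
have [_ [t Pt <-] Ft] := inf_adherent e0 Ein.
exists t => // t' Pt'.
have : inf E <= F t' by apply: ge_inf; [case: Ein|exists t'].
lra.
Qed.

Lemma int_translate_itv x : exists k : int, x - 1 < k%:~R <= x.
Proof.
exists (Num.floor x); have /andP[h1 h2] := floor_itv x.
by rewrite intrD in h2; apply/andP; split; lra.
Qed.

(** With [s] the square root of the quarter discriminant, the polynomial equals
    [A * r ^+ 2 + 2 * s * r] at signed distance [r] from a root, and an integer translate of [xi]
    comes within distance one of that root. For [A = 0] the polynomial is affine with slope
    [2 * B]. *)
Lemma quad_near_root (A B C rho xi : R) : 0 <= rho ->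
  0 <= B ^+ 2 - A * C <= rho ^+ 2 -> (A != 0 \/ 0 < B ^+ 2 - A * C) ->
  exists k : int, let y := xi + k%:~R in
    `|A * y ^+ 2 + 2 * B * y + C| <= 2 * rho + `|A|.
Proof.
move=> rho0 /andP[d0 drho] hA.
have [A0|A0] := eqVneq A 0.
  have dB : 0 < B ^+ 2 by case: hA; [rewrite A0 eqxx | rewrite A0 mul0r subr0].
  have B0 : B != 0 by apply: contraTneq dB => ->; rewrite expr0n ltxx.
  have [k /andP[k1 k2]] := int_translate_itv (- C / (2 * B) - xi).
  exists k => /=; set y := xi + _.
  have -> : A * y ^+ 2 + 2 * B * y + C = 2 * B * (y - (- C / (2 * B))).
    by rewrite A0; field.
  have Brho : `|B| <= rho.
    rewrite -ler_sqr ?nnegrE// real_normK ?num_real//.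
    by move: drho; rewrite A0 mul0r subr0.
  rewrite !normrM A0 normr0 addr0 (ger0_norm (ler0n _ 2)) -mulrA ler_pM2l//.
  rewrite -[leRHS]mulr1 ler_pM// ler_norml; apply/andP; split; rewrite /y; lra.
pose s := Num.sqrt (B ^+ 2 - A * C).
have s2 : s ^+ 2 = B ^+ 2 - A * C by rewrite sqr_sqrtr.
have s0 : 0 <= s by rewrite sqrtr_ge0.
have srho : s <= rho by rewrite -ler_sqr ?nnegrE// s2.
have [k /andP[k1 k2]] := int_translate_itv ((- B + s) / A - xi).
exists k => /=; set y := xi + _.
pose r := y - (- B + s) / A.
have -> : A * y ^+ 2 + 2 * B * y + C = A * r ^+ 2 + 2 * s * r.
  have -> : C = (B ^+ 2 - s ^+ 2) / A by rewrite s2; field.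
  by rewrite /r; field.
have r1 : -1 < r <= 0 by apply/andP; split; rewrite /r /y; lra.
have nr : `|r| <= 1 by rewrite ler_norml; lra.
apply: le_trans (ler_normD _ _) _.
rewrite addrC lerD// !normrM; last first.
  by rewrite -[leRHS]mulr1 ler_pM// ?mulr_ge0// mulr_ile1.
rewrite (ger0_norm (ler0n _ 2)) (ger0_norm s0).
by have := ler_wpM2l s0 nr; lra.
Qed.

(* Replacing the form by its value on a near-minimal primitive vector is one
   step of Gauss reduction; no definiteness is needed for the bound on [a']. *)
Lemma binary_reduction (a b c : R) : a * c - b ^+ 2 != 0 ->
  exists p q r s : int, p * s - q * r = 1 /\
   (let a' := a * p%:~R ^+ 2 + 2 * b * p%:~R * q%:~R + c * q%:~R ^+ 2 in
    let b' := a * p%:~R * r%:~R + b * (p%:~R * s%:~R + q%:~R * r%:~R)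
              + c * q%:~R * s%:~R in
    a' ^+ 2 <= 4 * `|a * c - b ^+ 2| /\ (a' != 0 -> 2 * `|b'| <= `|a'|)).
Proof.
move=> d0; pose D := `|a * c - b ^+ 2|.
have D0 : 0 < D by rewrite normr_gt0.
pose bas (t : int * int * int * int) :=
  let: (p, q, r, s) := t in p * s - q * r = 1.
pose fa (p q : int) := a * p%:~R ^+ 2 + 2 * b * p%:~R * q%:~R + c * q%:~R ^+ 2.
pose fb (p q r s : int) : R := a * p%:~R * r%:~R
   + b * (p%:~R * s%:~R + q%:~R * r%:~R) + c * q%:~R * s%:~R.
pose F (t : int * int * int * int) := let: (p, q, r, s) := t in `|fa p q|.
have red p q r s : bas (p, q, r, s) -> fa p q != 0 ->
    exists r' s', bas (p, q, r', s') /\ 2 * `|fb p q r' s'| <= `|fa p q|.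
  move=> hb f0.
  have [k /andP[k1 k2]] := int_translate_itv (fb p q r s / fa p q + 1/2).
  exists (r - k * p), (s - k * q); split; first by rewrite /bas -hb; ring.
  have -> : fb p q (r - k * p) (s - k * q) =
      fa p q * (fb p q r s / fa p q - k%:~R).
    rewrite mulrBr mulrCA divff// mulr1 /fb /fa !intrD !intrN !intrM; ring.
  rewrite normrM mulrCA -[leRHS]mulr1 ler_pM2l ?normr_gt0//.
  have : `|fb p q r s / fa p q - k%:~R| <= 1/2.
    by rewrite ler_norml; apply/andP; split; lra.
  by lra.
have disc p q r s : bas (p, q, r, s) ->
    fa p q * fa r s - fb p q r s ^+ 2 = a * c - b ^+ 2.
  move=> hb; have h : (p%:~R * s%:~R - q%:~R * r%:~R : R) = 1.
    by rewrite -!intrM -intrB hb.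
  rewrite -[RHS]mulr1 -(expr1n _ 2) -h /fa /fb; ring.
suff [p [q [r [s [hb ha]]]]] : exists p q r s, bas (p, q, r, s) /\
    fa p q ^+ 2 <= 4 * D.
  have [f0|f0] := eqVneq (fa p q) 0.
    by exists p, q, r, s; split=> //; split=> //; rewrite -/(fa p q) f0 eqxx.
  have [r' [s' [hb' hr]]] := red _ _ _ _ hb f0.
  by exists p, q, r', s'.
(* Otherwise every primitive value exceeds [2 * sqrt D] in absolute value, so these values are
   bounded below and a near-minimal one exists. *)
apply: contrapT => hn.
have big p q r s : bas (p, q, r, s) -> 4 * D < fa p q ^+ 2.
  move=> hb; rewrite ltNge; apply/negP => hle; apply: hn.
  by exists p, q, r, s.
have sD0 : 0 < Num.sqrt D by rewrite sqrtr_gt0.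
have [||[[[p q] r] s] hb hmin] := @near_inf _ bas F (Num.sqrt D) sD0.
- by exists (1, 0, 0, 1); rewrite /bas; ring.
- move=> [[[p q] r] s] /big h /=.
  rewrite -ler_sqr ?nnegrE ?sqrtr_ge0// real_normK ?num_real// sqr_sqrtr ?ltW//.
  lra.
have fb0 : fa p q != 0.
  by apply/eqP => f0; have := big _ _ _ _ hb; rewrite f0 expr0n /=; lra.
have [r' [s' [hb' hr]]] := red _ _ _ _ hb fb0.
(* The exchanged basis is a competitor, so the second diagonal value is almost as large as the
   first. As the off-diagonal entry is at most half the first, the determinant becomes too large. *)
have hb2 : bas (r', s', - p, - q) by rewrite /bas -hb'; ring.
have := hmin _ hb2 => /= hc.
have := disc _ _ _ _ hb' => hd.
have hac : `|fa p q| * `|fa r' s'| <= `|fb p q r' s'| ^+ 2 + D.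
  rewrite -normrM -normrX /D -hd; set X := fa _ _ * _; set Y := _ ^+ 2.
  by have := ler_normD Y (X - Y); rewrite addrCA subrr addr0.
have := big _ _ _ _ hb; rewrite -(real_normK (num_real (fa p q))).
move: hc hr hac; have := normr_ge0 (fb p q r' s').
have := normr_ge0 (fa p q); have := normr_ge0 (fa r' s').
move: `|fa p q| `|fa r' s'| `|fb p q r' s'| => u w v; nra.
Qed.

End Basics.

(** * Crossing arguments for forms with a small leading coefficient *)

Section TernaryCoordinates.
Variable R : realType.

Definition ternary (d B n al b e x y z : R) : R :=
  d * x ^+ 2 + 2 * B * x * y + n * y ^+ 2 + 2 * al * x * z
  + 2 * b * y * z + e * z ^+ 2.

(* Completing the square along the first coordinate, the value [tau] is crossed
   with squared half-slope [D = N + d * tau], where [N] is a binary form of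
   discriminant [theta]; a second crossing argument, now for [N], makes [D]
   small and nonnegative. *)
Lemma ternary_dense_of_small (eps tau : R) : 0 < eps ->
  exists2 eta : R, 0 < eta &
  forall d B n al b e : R, 0 < d < eta ->
    0 < (B * al - d * b) ^+ 2 - (B ^+ 2 - d * n) * (al ^+ 2 - d * e) < eta ->
    forall xi1 xi2 xi3 : R, exists x y z : int,
      `|ternary d B n al b e (xi1 + x%:~R) (xi2 + y%:~R) (xi3 + z%:~R) - tau|
      < eps.
Proof.
(* The crossing in [x] tolerates a squared half-slope up to [(eps / 4) ^+ 2 = 2 * k]; the crossing
   in [Y] aims it at [k]. *)
move=> eps0; pose k := eps ^+ 2 / 32.
have k0 : 0 < k by rewrite /k; nra.
have t0 : 0 < 1 + `|tau| by have := normr_ge0 tau; lra.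
exists (Num.min (eps / 2) (Num.min (k / (1 + `|tau|)) ((k / 512) ^+ 2))).
  have e1 : 0 < eps / 2 by lra.
  have e2 : 0 < k / (1 + `|tau|) by apply: divr_gt0.
  have e3 : 0 < (k / 512) ^+ 2 by apply: exprn_gt0; lra.
  by rewrite !lt_min e1 e2 e3.
move=> d B n al b e /andP[d0 deta].
pose th := (B * al - d * b) ^+ 2 - (B ^+ 2 - d * n) * (al ^+ 2 - d * e).
rewrite -/th => /andP[th0 theta] xi1 xi2 xi3.
move: deta theta; rewrite !lt_min => /and3P[d1 d2 _] /and3P[_ _ th1].
have dtau : `|d * tau| <= k.
  rewrite normrM (gtr0_norm d0).
  move: d2; rewrite ltr_pdivlMr// => d2.
  by have := normr_ge0 tau; nra.
have [|p [q [r [s [hb [ha _]]]]]] :=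
  @binary_reduction R (B ^+ 2 - d * n) (B * al - d * b) (al ^+ 2 - d * e).
  by apply/eqP => h; move: th0; rewrite /th -opprB h oppr0 ltxx.
have {}hb : (p%:~R * s%:~R - q%:~R * r%:~R : R) = 1.
  by rewrite -!intrM -intrB hb.
move: ha; set N22 := (X in X ^+ 2 <= _).
rewrite -normrN opprB -/th (gtr0_norm th0) => hN.
pose N23 : R := (B ^+ 2 - d * n) * p%:~R * r%:~R
   + (B * al - d * b) * (p%:~R * s%:~R + q%:~R * r%:~R)
   + (al ^+ 2 - d * e) * q%:~R * s%:~R.
pose N33 : R := (B ^+ 2 - d * n) * r%:~R ^+ 2
   + 2 * (B * al - d * b) * r%:~R * s%:~R + (al ^+ 2 - d * e) * s%:~R ^+ 2.
have hdet : N23 ^+ 2 - N22 * N33 = th.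
  by rewrite -[RHS]mulr1 -(expr1n _ 2) -hb /N22 /N23 /N33 /th; ring.
have N22k : `|N22| <= k / 256.
  rewrite -ler_sqr ?nnegrE//; last by rewrite divr_ge0 ?ltW.
  by rewrite real_normK ?num_real//; lra.
pose w := Num.sqrt th.
have w2 : w ^+ 2 = th by rewrite sqr_sqrtr ?ltW.
have w0 : 0 < w by rewrite sqrtr_gt0.
have wk : w <= k / 8.
  have h : w ^+ 2 <= (k / 8) ^+ 2.
    by rewrite w2; have := exprn_gt0 2 k0; lra.
  nra.
pose eta2 := s%:~R * xi2 - r%:~R * xi3.
pose eta3 := p%:~R * xi3 - q%:~R * xi2.
(* This puts [w * ze] in [[k / 8, k / 4]]. The quadratic in [Y] then has a discriminant large enough
   for a real root, yet small enough that some integer translate keeps its value within [k] of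
   zero. *)
have [k3 /andP[k3l k3u]] := int_translate_itv (k / (4 * w) - eta3).
pose ze := eta3 + k3%:~R.
have zeu : w * ze <= k / 4.
  have : ze <= k / (4 * w) by rewrite /ze; lra.
  by rewrite ler_pdivlMr ?mulr_gt0//; lra.
have zel : k / 8 <= w * ze.
  have : k / (4 * w) <= ze + 1 by rewrite /ze; lra.
  by rewrite ler_pdivrMr ?mulr_gt0//; lra.
have kt : `|k - d * tau| <= 2 * k.
  apply: le_trans (ler_normB _ _) _; rewrite (gtr0_norm k0); lra.
have hNk : `|N22 * (k - d * tau)| <= k ^+ 2 / 128.
  rewrite normrM; apply: le_trans (ler_pM _ _ N22k kt) _ => //; lra.
have hthl : k ^+ 2 / 64 <= (w * ze) ^+ 2 by nra.
have hthu : (w * ze) ^+ 2 <= k ^+ 2 / 16 by nra.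
have disc : (N23 * ze) ^+ 2 - N22 * (N33 * ze ^+ 2 + d * tau - k) =
    (w * ze) ^+ 2 + N22 * (k - d * tau).
  by rewrite [(w * ze) ^+ 2]exprMn w2 -hdet; ring.
have k20 : 0 < k ^+ 2 by rewrite exprn_gt0.
have [|||k2 /=] := @quad_near_root R N22 (N23 * ze)
    (N33 * ze ^+ 2 + d * tau - k) (3 / 10 * k) eta2; first by lra.
- move: hNk; rewrite disc ler_norml => /andP[h1 h2]; apply/andP; split; lra.
- by right; move: hNk; rewrite disc ler_norml => /andP[h1 h2]; lra.
set Y := eta2 + _ => hY.
pose y := p%:~R * Y + r%:~R * ze; pose z := q%:~R * Y + s%:~R * ze.
have yE : y = xi2 + (p * k2 + r * k3)%:~R.
  rewrite intrD !intrM -[X in _ = X + _]mul1r -[X in _ = X * _ + _]hb.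
  by rewrite /y /Y /ze /eta2 /eta3; ring.
have zE : z = xi3 + (q * k2 + s * k3)%:~R.
  rewrite intrD !intrM -[X in _ = X + _]mul1r -[X in _ = X * _ + _]hb.
  by rewrite /z /Y /ze /eta2 /eta3; ring.
have disc2 : (B * y + al * z) ^+ 2 -
      d * (n * y ^+ 2 + 2 * b * y * z + e * z ^+ 2 - tau) =
    N22 * Y ^+ 2 + 2 * (N23 * ze) * Y + (N33 * ze ^+ 2 + d * tau - k) + k.
  by rewrite /y /z /N22 /N23 /N33; ring.
have [|||k1 /=] := @quad_near_root R d (B * y + al * z)
  (n * y ^+ 2 + 2 * b * y * z + e * z ^+ 2 - tau) (eps / 4) xi1.
- by lra.
- rewrite disc2; move: hY; rewrite ler_norml => /andP[h1 h2].
  have kE : (eps / 4) ^+ 2 = 2 * k by rewrite /k; field.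
  rewrite kE; move: N22k => h3; apply/andP; split; lra.
- by left; rewrite gt_eqF.
move=> hx; exists k1, (p * k2 + r * k3), (q * k2 + s * k3).
rewrite -yE -zE; move: hx; rewrite (gtr0_norm d0).
set X := xi1 + _; set u := (X in `|X| <= _); set v := (X in `|X| < _).
have -> : v = u by rewrite /u /v /ternary; ring.
by move=> h; apply: le_lt_trans h _; lra.
Qed.

(** For second coordinate [k] the form is a concave quadratic in [x] with maximum
    [k ^+ 2 * N / - d]. The least admissible size of [k] lifts this maximum to [m / 2], so that the
    level [m / 2] is crossed with small slope. *)
Lemma binary_crossing (m d B n : R) : 0 < m -> - (m / 64) <= d < 0 ->
  0 < B ^+ 2 - d * n <= m ^+ 2 / 256 ->
  exists x y : int,
    0 < d * x%:~R ^+ 2 + 2 * B * x%:~R * y%:~R + n * y%:~R ^+ 2 < m.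
Proof.
move=> m0 /andP[d1 d0]; set N := _ - _ => /andP[N0 N1].
pose X := Num.sqrt (- d * m / (2 * N)).
have X2 : X ^+ 2 = - d * m / (2 * N).
  by rewrite sqr_sqrtr// divr_ge0 ?mulr_ge0 ?ltW// oppr_gt0.
have X0 : 0 <= X by rewrite sqrtr_ge0.
have [k /andP[kl ku]] := int_translate_itv (X + 1).
have XN : X ^+ 2 * N = - d * m / 2 by rewrite X2; field; rewrite gt_eqF.
have kN1 : - d * m / 2 <= k%:~R ^+ 2 * N by rewrite -XN ler_pM2r//; nra.
have kN2 : k%:~R ^+ 2 * N <= - d * m + 2 * N.
  have -> : - d * m + 2 * N = (2 * X ^+ 2 + 2) * N by have := XN; lra.
  have h1 : k%:~R ^+ 2 <= (X + 1) ^+ 2 by rewrite ler_sqr ?nnegrE; lra.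
  by have := sqr_ge0 (X - 1); rewrite ler_pM2r//; lra.
have [|||x /=] := @quad_near_root R d (B * k%:~R) (n * k%:~R ^+ 2 - m / 2) (m / 8) 0.
- lra.
- have -> : (B * k%:~R) ^+ 2 - d * (n * k%:~R ^+ 2 - m / 2) =
     k%:~R ^+ 2 * N + d * m / 2 by rewrite /N; ring.
  have : - d * m <= m / 64 * m by rewrite ler_pM2r//; lra.
  by move=> h; apply/andP; split; lra.
- by left; rewrite lt_eqF.
rewrite add0r (ltr0_norm d0) ler_norml => /andP[h1 h2].
exists x, k; apply/andP; split; lra.
Qed.

End TernaryCoordinates.

(** * Integral matrices and small values *)

Definition o0 : 'I_3 := @Ordinal 3 0 isT.
Definition o1 : 'I_3 := @Ordinal 3 1 isT.
Definition o2 : 'I_3 := @Ordinal 3 2 isT.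

Lemma ord3_ind (P : 'I_3 -> Prop) : P o0 -> P o1 -> P o2 -> forall i, P i.
Proof.
move=> h0 h1 h2 [[|[|[|//]]] hi].
- by rewrite (_ : Ordinal hi = o0) //; apply: val_inj.
- by rewrite (_ : Ordinal hi = o1) //; apply: val_inj.
- by rewrite (_ : Ordinal hi = o2) //; apply: val_inj.
Qed.

Lemma sum3 (V : nmodType) (F : 'I_3 -> V) : \sum_i F i = F o0 + F o1 + F o2.
Proof.
rewrite !big_ord_recl big_ord0 addr0 addrA.
by congr (F _ + F _ + F _); apply: val_inj.
Qed.

Section Matrices.
Variable K : comNzRingType.

Definition mx3 (a b c d e f g h i : K) : 'M[K]_3 :=
  \matrix_(j < 3, k < 3) nth 0 (nth [::]
    [:: [:: a; b; c]; [:: d; e; f]; [:: g; h; i]] j) k.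

Definition cv3 (a b c : K) : 'cV[K]_3 := \col_(j < 3) nth 0 [:: a; b; c] j.

Lemma mx3E (A : 'M[K]_3) : A = mx3 (A o0 o0) (A o0 o1) (A o0 o2)
  (A o1 o0) (A o1 o1) (A o1 o2) (A o2 o0) (A o2 o1) (A o2 o2).
Proof.
by apply/matrixP; apply: ord3_ind; apply: ord3_ind; rewrite !mxE.
Qed.

Lemma mulmx3 m n (A : 'M[K]_(m, 3)) (B : 'M[K]_(3, n)) i j :
  (A *m B) i j = A i o0 * B o0 j + A i o1 * B o1 j + A i o2 * B o2 j.
Proof. by rewrite mxE sum3. Qed.

Lemma det2 (A : 'M[K]_2) :
  \det A = A 0 0 * A (lift 0 0) (lift 0 0) - A 0 (lift 0 0) * A (lift 0 0) 0.
Proof.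
rewrite (expand_det_row _ 0) !big_ord_recl big_ord0 addr0 /cofactor !det_mx11.
rewrite !mxE /= expr0 mul1r expr1 mulN1r mulrN.
by congr (_ * A _ _ - _ * A _ _); apply: val_inj.
Qed.

Lemma det3 (A : 'M[K]_3) : \det A =
  A o0 o0 * (A o1 o1 * A o2 o2 - A o1 o2 * A o2 o1)
  - A o0 o1 * (A o1 o0 * A o2 o2 - A o1 o2 * A o2 o0)
  + A o0 o2 * (A o1 o0 * A o2 o1 - A o1 o1 * A o2 o0).
Proof.
rewrite (expand_det_row _ o0) sum3 /cofactor !det2 !mxE /=.
have e1 : lift o0 (0 : 'I_2) = o1 by apply: val_inj.
have e2 : lift o0 (lift 0 0 : 'I_2) = o2 by apply: val_inj.
have e3 : lift o1 (0 : 'I_2) = o0 by apply: val_inj.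
have e4 : lift o1 (lift 0 0 : 'I_2) = o2 by apply: val_inj.
have e5 : lift o2 (0 : 'I_2) = o0 by apply: val_inj.
have e6 : lift o2 (lift 0 0 : 'I_2) = o1 by apply: val_inj.
rewrite !e1 !e2 !e3 !e4 !e5 !e6; ring.
Qed.

End Matrices.

Section IntegerMatrices.
Variable R : realType.

Definition zmx m n (M : 'M[int]_(m, n)) : 'M[R]_(m, n) := map_mx intr M.

Lemma zmxM m n p (A : 'M[int]_(m, n)) (B : 'M[int]_(n, p)) :
  zmx (A *m B) = zmx A *m zmx B.
Proof. exact: map_mxM. Qed.

Lemma zmx1 n : zmx (1%:M : 'M_n) = 1%:M.
Proof. exact: map_mx1. Qed.

Lemma det_zmx n (A : 'M[int]_n) : \det (zmx A) = (\det A)%:~R.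
Proof. exact: det_map_mx. Qed.

Lemma zmxE m n (A : 'M[int]_(m, n)) i j : zmx A i j = (A i j)%:~R.
Proof. by rewrite mxE. Qed.

Definition SLz n (A : 'M[int]_n) := \det A = 1.

Lemma SLz_unit n (A : 'M[int]_n) : SLz A -> A \in unitmx.
Proof. by rewrite unitmxE => ->; rewrite unitr1. Qed.

Lemma SLzM n (A B : 'M[int]_n) : SLz A -> SLz B -> SLz (A *m B).
Proof. by rewrite /SLz det_mulmx => -> ->; rewrite mulr1. Qed.

Lemma SLzV n (A : 'M[int]_n) : SLz A -> SLz (invmx A).
Proof. by rewrite /SLz det_inv => ->; rewrite invr1. Qed.

Lemma zmxK n (A : 'M[int]_n) : SLz A -> zmx A *m zmx (invmx A) = 1%:M.
Proof. by move=> h; rewrite -zmxM mulmxV ?zmx1// SLz_unit. Qed.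

Lemma zmxVK n (A : 'M[int]_n) : SLz A -> zmx (invmx A) *m zmx A = 1%:M.
Proof. by move=> h; rewrite -zmxM mulVmx ?zmx1// SLz_unit. Qed.

(** The Smith normal form of a column exhibits [v] as a multiple of the first column of a unimodular
    matrix; negating the last column corrects a determinant [-1]. *)
Lemma primitive_basis (v : 'cV[int]_3) : v != 0 ->
  exists (g : 'M[int]_3) (k : int), [/\ SLz g, k != 0 & v = k *: col o0 g].
Proof.
move=> v0; have [L uL [P uP [d _ hv]]] := int_Smith_normal_form v.
pose k := d`_0 * P 0 0.
have vE : v = k *: col o0 L.
  apply/matrixP => i j; rewrite [j]ord1 {1}hv mxE big_ord1 mulmx3 !mxE /=.
  by rewrite mulr0n !mulr0 !addr0 mulr1n /k; ring.
have k0 : k != 0 by apply: contraNneq v0 => k0; rewrite vE k0 scale0r.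
have : \det L \is a GRing.unit by rewrite -unitmxE.
case/orP => /eqP dL; first by exists L, k.
exists (L *m mx3 1 0 0 0 1 0 0 0 (-1)), k; split=> //.
  by rewrite /SLz det_mulmx dL det3 !mxE /=; ring.
rewrite {1}vE; congr (_ *: _); apply/matrixP => i j.
by rewrite !mxE sum3 !mxE /= mulr1 !mulr0 !addr0.
Qed.

Lemma intr_sqr_ge1 (k : int) : k != 0 -> 1 <= (k%:~R : R) ^+ 2.
Proof.
move=> k0; rewrite -rmorphXn /= ler1z; move: k0; by case: k => [[|n]|n].
Qed.

Definition qf (S : 'M[R]_3) (x : 'cV[R]_3) : R := (x^T *m S *m x) 0 0.

Lemma qfE S x : S^T = S -> qf S x =
  ternary (S o0 o0) (S o0 o1) (S o1 o1) (S o0 o2) (S o1 o2) (S o2 o2)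
    (x o0 0) (x o1 0) (x o2 0).
Proof.
move=> /matrixP sS.
have := sS o0 o1; have := sS o0 o2; have := sS o1 o2.
rewrite /qf !mulmx3 !mxE => -> -> ->; rewrite /ternary; ring.
Qed.

Lemma qf_mul S P x : qf S (P *m x) = qf (P^T *m S *m P) x.
Proof. by rewrite /qf trmx_mul !mulmxA. Qed.

Lemma qfZ S k x : qf S (k *: x) = k ^+ 2 * qf S x.
Proof. by rewrite /qf !mulmx3 !mxE; ring. Qed.

Lemma sym_conj (S P : 'M[R]_3) : S^T = S -> (P^T *m S *m P)^T = P^T *m S *m P.
Proof. by move=> h; rewrite !trmx_mul trmxK h mulmxA. Qed.

Lemma qf_col0 S : qf S (cv3 1 0 0) = S o0 o0.
Proof. by rewrite /qf !mulmx3 !mxE /=; ring. Qed.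

Lemma col0E (g : 'M[int]_3) : zmx (col o0 g) = zmx g *m cv3 1 0 0.
Proof.
apply/matrixP => i j; rewrite mulmx3 !mxE /=; ring.
Qed.

(** Take a basis starting with the primitive part of [v]. Its leading coefficient is small and
    positive, and the binary form left after completing the square has discriminant
    [T o0 o0 * - \det S], small as well, so [ternary_dense_of_small] applies. *)
Lemma dense_of_small_values (S : 'M[R]_3) : S^T = S -> \det S < 0 ->
  (forall eta, 0 < eta -> exists v : 'cV[int]_3, 0 < qf S (zmx v) < eta) ->
  forall (xi : 'cV[R]_3) (tau eps : R), 0 < eps ->
  exists t : 'cV[int]_3, `|qf S (xi + zmx t) - tau| < eps.
Proof.
move=> sS dS small xi tau eps eps0.
have [eta eta0 H] := ternary_dense_of_small tau eps0.
have e1 : 0 < eta / - \det S by apply: divr_gt0 => //; lra.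
have [|v /andP[v0]] := small (Num.min eta (eta / - \det S)).
  by rewrite lt_min eta0.
rewrite lt_min => /andP[v1 v2].
have vn0 : v != 0.
  by apply: contraTneq v0 => ->; rewrite /qf /zmx map_mx0 mulmx0 mxE ltxx.
have [g [k [sg k0 vE]]] := primitive_basis vn0.
pose T := (zmx g)^T *m S *m zmx g.
have sT : T^T = T by apply: sym_conj.
have dT : \det T = \det S by rewrite !det_mulmx det_tr det_zmx sg; ring.
have vT : qf S (zmx v) = k%:~R ^+ 2 * T o0 o0.
  have -> : zmx v = k%:~R *: zmx (col o0 g).
    by rewrite vE; apply/matrixP => i j; rewrite !mxE intrM.
  by rewrite qfZ col0E qf_mul qf_col0.
have k1 := intr_sqr_ge1 k0.
have T0 : 0 < T o0 o0.
  by move: v0; rewrite vT pmulr_rgt0//; lra.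
have T1 : T o0 o0 <= qf S (zmx v) by rewrite vT; nra.
have th : (T o0 o1 * T o0 o2 - T o0 o0 * T o1 o2) ^+ 2 -
   (T o0 o1 ^+ 2 - T o0 o0 * T o1 o1) * (T o0 o2 ^+ 2 - T o0 o0 * T o2 o2)
   = T o0 o0 * - \det S.
  have s01 : T o1 o0 = T o0 o1 by rewrite -{1}sT mxE.
  have s02 : T o2 o0 = T o0 o2 by rewrite -{1}sT mxE.
  have s12 : T o2 o1 = T o1 o2 by rewrite -{1}sT mxE.
  by rewrite -dT det3 s01 s02 s12; ring.
pose xi' := zmx (invmx g) *m xi.
have [||x [y [z hxyz]]] := H (T o0 o0) (T o0 o1) (T o1 o1) (T o0 o2) (T o1 o2)
   (T o2 o2) _ _ (xi' o0 0) (xi' o1 0) (xi' o2 0).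
- by rewrite T0; lra.
- rewrite th; apply/andP; split; first by apply: mulr_gt0 => //; lra.
  by rewrite -ltr_pdivlMr; lra.
exists (g *m cv3 x y z).
have -> : xi + zmx (g *m cv3 x y z) = zmx g *m (xi' + zmx (cv3 x y z)).
  by rewrite mulmxDr zmxM /xi' mulmxA zmxK// mul1mx.
by rewrite qf_mul -/T qfE// !mxE /=; move: hxyz; rewrite !mxE.
Qed.

Definition zindep (a b : R) :=
  forall p q : int, p%:~R * a + q%:~R * b = 0 -> p = 0 /\ q = 0.

(** Otherwise the combinations form a discrete group. A near-minimal nonzero element [u] then
    divides all of them, since a nonzero remainder would be at most half of [u]; so [a] and [b] are
    commensurable. *)
Lemma zindep_small (a b eps : R) : zindep a b -> 0 < eps ->
  exists p q : int, 0 < `|p%:~R * a + q%:~R * b| < eps.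
Proof.
move=> ab eps0; apply: contrapT => hn.
pose P (t : int * int) := t.1%:~R * a + t.2%:~R * b != 0.
pose F (t : int * int) := `|t.1%:~R * a + t.2%:~R * b|.
have hF t : P t -> eps <= F t.
  move=> Pt; rewrite leNgt; apply/negP => hlt; apply: hn.
  by exists t.1, t.2; apply/andP; split; rewrite ?normr_gt0.
have a0 : a != 0.
  apply/eqP => a0; have [] := ab 1 0; last by [].
  by rewrite a0 mulr0 mul0r addr0.
have [|[p q] /= Pt hmin] := near_inf eps0 _ hF.
  by exists (1, 0); rewrite /P /= mul1r mul0r addr0.
set u := p%:~R * a + q%:~R * b in Pt.
have mult (p' q' : int) : exists k : int, p'%:~R * a + q'%:~R * b = k%:~R * u.
  have [k /andP[k1 k2]] :=
    int_translate_itv ((p'%:~R * a + q'%:~R * b) / u + 1 / 2).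
  exists k; apply/eqP; rewrite -subr_eq0; apply/negPn/negP => h0.
  have E : (p' - k * p)%:~R * a + (q' - k * q)%:~R * b =
      p'%:~R * a + q'%:~R * b - k%:~R * u.
    by rewrite !intrB !intrM /u; ring.
  have := hmin (p' - k * p, q' - k * q); rewrite /P /F /= -/u E => /(_ h0).
  have -> : p'%:~R * a + q'%:~R * b - k%:~R * u =
     ((p'%:~R * a + q'%:~R * b) / u - k%:~R) * u by field.
  rewrite normrM leNgt ltr_pM2r ?normr_gt0// => /negP; apply.
  by apply: le_lt_trans (_ : 1 / 2 < _); [rewrite ler_norml; lra | lra].
have [k ka] := mult 1 0; have [l lb] := mult 0 1.
have [] := ab l (- k).
  by move: ka lb; rewrite intrN mul1r !mul0r addr0 add0r mul1r => {1}-> {1}->; ring.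
move=> l0 /eqP; rewrite oppr_eq0 => /eqP k0.
by move: ka; rewrite k0 mul1r !mul0r addr0 => /eqP; rewrite (negPf a0).
Qed.

End IntegerMatrices.

(** * Isotropic vectors and values near zero of diagonal forms *)

Section DiagonalForms.
Variable R : realType.

Definition diag3 (c1 c2 c3 : R) : 'M[R]_3 := mx3 c1 0 0 0 c2 0 0 0 c3.

Definition bf (S : 'M[R]_3) (x y : 'cV[R]_3) : R := (x^T *m S *m y) 0 0.

Lemma bf_mul S P x y : bf S (P *m x) (P *m y) = bf (P^T *m S *m P) x y.
Proof. by rewrite /bf trmx_mul !mulmxA. Qed.

Lemma zmx_cv3 a b c : zmx R (cv3 a b c) = cv3 a%:~R b%:~R c%:~R.
Proof.
apply/matrixP => i j; rewrite [j]ord1 !mxE; move: i.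
by apply: ord3_ind.
Qed.

Lemma qf_cv3 (T : 'M[R]_3) x y z : T^T = T -> qf T (cv3 x y z) = ternary
  (T o0 o0) (T o0 o1) (T o1 o1) (T o0 o2) (T o1 o2) (T o2 o2) x y z.
Proof. by move=> sT; rewrite qfE// !mxE. Qed.

Lemma bf_e1 (T : 'M[R]_3) p q : bf T (cv3 1 0 0) (cv3 0 p q) =
  p * T o0 o1 + q * T o0 o2.
Proof. by rewrite /bf !mulmx3 !mxE /=; ring. Qed.

Lemma lincomb_entry (x y : 'cV[R]_3) s t i :
  (s *: x - t *: y) i 0 = s * x i 0 - t * y i 0.
Proof. by rewrite !mxE. Qed.

Lemma qf_diag3 c1 c2 c3 x : qf (diag3 c1 c2 c3) x =
  c1 * x o0 0 ^+ 2 + c2 * x o1 0 ^+ 2 + c3 * x o2 0 ^+ 2.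
Proof. by rewrite /qf !mulmx3 !mxE /=; ring. Qed.

Lemma bf_diag3 c1 c2 c3 x y : bf (diag3 c1 c2 c3) x y =
  c1 * x o0 0 * y o0 0 + c2 * x o1 0 * y o1 0 + c3 * x o2 0 * y o2 0.
Proof. by rewrite /bf !mulmx3 !mxE /=; ring. Qed.

Lemma sym_diag3 c1 c2 c3 : (diag3 c1 c2 c3)^T = diag3 c1 c2 c3.
Proof. by apply/matrixP; apply: ord3_ind; apply: ord3_ind; rewrite !mxE. Qed.

Lemma det_diag3 c1 c2 c3 : \det (diag3 c1 c2 c3) = c1 * c2 * c3.
Proof. by rewrite det3 !mxE /=; ring. Qed.

Lemma qf_line c1 c2 c3 (e v : 'cV[int]_3) (t : int) :
  qf (diag3 c1 c2 c3) (zmx R (e + t *: v)) = qf (diag3 c1 c2 c3) (zmx R e)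
   + 2 * t%:~R * bf (diag3 c1 c2 c3) (zmx R e) (zmx R v)
   + t%:~R ^+ 2 * qf (diag3 c1 c2 c3) (zmx R v).
Proof. by rewrite !qf_diag3 bf_diag3 !mxE !intrD !intrM; ring. Qed.

(** Along [e + t *: v] the form is affine in [t], with step [2 * be] shorter than [m / 2]; it is
    steered next to [m / 2]. *)
Lemma hit_of_isotropic c1 c2 c3 m (e v : 'cV[int]_3) :
  qf (diag3 c1 c2 c3) (zmx R v) = 0 ->
  0 < `|bf (diag3 c1 c2 c3) (zmx R e) (zmx R v)| < m / 4 ->
  exists t : 'cV[int]_3, 0 < qf (diag3 c1 c2 c3) (zmx R t) < m.
Proof.
set S := diag3 _ _ _; set be := bf S _ _ => v0 /andP[be0 be1].
have ben0 : be != 0 by rewrite -normr_gt0.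
have [k /andP[k1 k2]] :=
  int_translate_itv ((m / 2 - qf S (zmx R e)) / (2 * be)).
exists (e + k *: v); rewrite qf_line v0 mulr0 addr0 -/be.
have : `|k%:~R - (m / 2 - qf S (zmx R e)) / (2 * be)| <= 1.
  by rewrite ler_norml; lra.
rewrite -(ler_pM2r be0) -normrM mul1r => h.
have : `|(k%:~R - (m / 2 - qf S (zmx R e)) / (2 * be)) * be| < m / 4 by lra.
have -> : (k%:~R - (m / 2 - qf S (zmx R e)) / (2 * be)) * be =
   k%:~R * be - (m / 2 - qf S (zmx R e)) / 2 by field.
by rewrite ltr_norml => /andP[h1 h2]; apply/andP; split; lra.
Qed.

(** By the signs, an isotropic [v <> 0] has a nonzero first coordinate and another nonzero one.
    Independence then makes the pairing of [v] with integer vectors take arbitrarily small nonzero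
    values, against [hit_of_isotropic]. *)
Lemma anisotropic (c1 c2 c3 m : R) : c1 < 0 -> 0 < c2 -> 0 < c3 -> 0 < m ->
  zindep c1 c2 -> zindep c1 c3 ->
  (forall v : 'cV[int]_3, ~ (0 < qf (diag3 c1 c2 c3) (zmx R v) < m)) ->
  forall v : 'cV[int]_3, qf (diag3 c1 c2 c3) (zmx R v) = 0 -> v = 0.
Proof.
move=> c1n c2p c3p m0 c12 c13 avoid v qv; apply: contrapT => vn0.
pose a := v o0 0; pose b := v o1 0; pose f := v o2 0.
have qv' : c1 * (a%:~R : R) ^+ 2 + c2 * b%:~R ^+ 2 + c3 * f%:~R ^+ 2 = 0.
  by rewrite -qv qf_diag3 !mxE.
have a0 : a != 0.
  apply/eqP => a0; apply: vn0.
  have hb0 : 0 <= c2 * (b%:~R : R) ^+ 2 by rewrite mulr_ge0 ?sqr_ge0// ltW.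
  have hf0 : 0 <= c3 * (f%:~R : R) ^+ 2 by rewrite mulr_ge0 ?sqr_ge0// ltW.
  move/eqP: qv'; rewrite a0 expr0n mulr0 add0r paddr_eq0// !mulf_eq0.
  rewrite (gt_eqF c2p) (gt_eqF c3p) /= !orbb !intr_eq0 => /andP[/eqP hb /eqP hf].
  apply/matrixP => i j; rewrite [j]ord1 mxE; move: i.
  by apply: ord3_ind; rewrite -/a -/b -/f.
have ar0 : (a%:~R : R) ^+ 2 > 0 by rewrite exprn_even_gt0 //= intr_eq0.
have indep (c : R) (x : int) : zindep c1 c -> x != 0 ->
    zindep (c1 * a%:~R) (c * x%:~R).
  move=> h x0 p q hpq; have [|pa qx] := h (p * a) (q * x).
    by rewrite !intrM -hpq; ring.
  by move/eqP: pa; move/eqP: qx; rewrite !mulf_eq0 (negPf a0) (negPf x0) !orbF;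
    move=> /eqP -> /eqP ->.
have m40 : 0 < m / 4 by rewrite divr_gt0.
have [b0|b0] := eqVneq b 0.
  have f0 : f != 0.
    apply/eqP => f0; move/eqP: qv'.
    by rewrite b0 f0 expr0n !mulr0 !addr0 mulf_eq0 (lt_eqF c1n) (gt_eqF ar0).
  have [p [q hpq]] := zindep_small (indep _ _ c13 f0) m40.
  have [|t ht] := @hit_of_isotropic c1 c2 c3 m (cv3 p 0 q) v qv; last exact: avoid ht.
  move: hpq; rewrite bf_diag3 !mxE /= -/a -/f.
  set x := (X in 0 < `|X| < _); set y := (X in _ -> is_true (0 < `|X| < _)).
  by have -> : y = x by rewrite /x /y; ring.
have [p [q hpq]] := zindep_small (indep _ _ c12 b0) m40.
have [|t ht] := @hit_of_isotropic c1 c2 c3 m (cv3 p q 0) v qv; last exact: avoid ht.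
move: hpq; rewrite bf_diag3 !mxE /= -/a -/b.
set x := (X in 0 < `|X| < _); set y := (X in _ -> is_true (0 < `|X| < _)).
by have -> : y = x by rewrite /x /y; ring.
Qed.

(** Zero is excluded by [anisotropic], so small negative values remain. Given one, let [d] be the
    value at the primitive part of [v]: reducing the binary form left after completing the square
    yields a plane through that vector with [0 < N <= K], on which [binary_crossing] finds a value
    in the forbidden interval. *)
Lemma gap_at_zero (c1 c2 c3 m : R) : c1 < 0 -> 0 < c2 -> 0 < c3 -> 0 < m ->
  zindep c1 c2 -> zindep c1 c3 ->
  (forall v : 'cV[int]_3, ~ (0 < qf (diag3 c1 c2 c3) (zmx R v) < m)) ->
  exists2 m' : R, 0 < m' &
  forall v : 'cV[int]_3, v != 0 -> m' <= `|qf (diag3 c1 c2 c3) (zmx R v)|.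
Proof.
move=> c1n c2p c3p m0 c12 c13 avoid; set S := diag3 c1 c2 c3.
have dS : \det S < 0 by rewrite det_diag3 pmulr_llt0// pmulr_llt0.
pose K := m ^+ 2 / 256.
have K0 : 0 < K by rewrite /K; nra.
have nS0 : 0 < - \det S by lra.
(* The first bound is what [binary_crossing] asks of [d]; the second turns
   [N ^+ 2 <= 4 * (- d * - \det S)] into [N <= K]. *)
pose eta := Num.min (m / 64) (K ^+ 2 / (4 * - \det S)).
have eta0 : 0 < eta.
  by rewrite lt_min; apply/andP; split; [lra | apply: divr_gt0; [nra|lra]].
exists eta => // v vn0.
have [qv0|qv0|qv0] := ltgtP (qf S (zmx R v)) 0; last first.
- by have := vn0; rewrite (anisotropic c1n c2p c3p m0 c12 c13 avoid qv0) eqxx.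
- rewrite gtr0_norm// leNgt; apply/negP; rewrite lt_min => /andP[h _].
  by apply: (avoid v); rewrite qv0; lra.
rewrite ltr0_norm// leNgt; apply/negP; rewrite lt_min => /andP[h1 h2].
have [g [k [sg k0 vE]]] := primitive_basis vn0.
pose T := (zmx R g)^T *m S *m zmx R g.
have sT : T^T = T by apply: sym_conj; apply: sym_diag3.
have dT : \det T = \det S by rewrite !det_mulmx det_tr det_zmx sg; ring.
have vT : qf S (zmx R v) = k%:~R ^+ 2 * T o0 o0.
  have -> : zmx R v = k%:~R *: zmx R (col o0 g).
    by rewrite vE; apply/matrixP => i j; rewrite !mxE intrM.
  by rewrite qfZ col0E qf_mul qf_col0.
have k1 := intr_sqr_ge1 R k0.
have T0 : T o0 o0 < 0 by move: qv0; rewrite vT pmulr_rlt0//; lra.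
have T1 : qf S (zmx R v) <= T o0 o0 by rewrite vT; nra.
pose B := T o0 o1; pose n := T o1 o1; pose al := T o0 o2; pose b := T o1 o2.
pose e := T o2 o2; pose d := T o0 o0.
have th : (B ^+ 2 - d * n) * (al ^+ 2 - d * e) - (B * al - d * b) ^+ 2 =
   - d * - \det S.
  have s01 : T o1 o0 = T o0 o1 by rewrite -{1}sT mxE.
  have s02 : T o2 o0 = T o0 o2 by rewrite -{1}sT mxE.
  have s12 : T o2 o1 = T o1 o2 by rewrite -{1}sT mxE.
  by rewrite -dT det3 s01 s02 s12 /d /B /n /al /b /e; ring.
have dd0 : 0 < - d * - \det S by apply: mulr_gt0; rewrite /d; lra.
have [|p [q [r [s [hb [ha _]]]]]] :=
  @binary_reduction R (B ^+ 2 - d * n) (B * al - d * b) (al ^+ 2 - d * e).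
  by rewrite th gt_eqF.
move: ha; rewrite th (gtr0_norm dd0).
pose B' := p%:~R * B + q%:~R * al.
pose n' := n * p%:~R ^+ 2 + 2 * b * p%:~R * q%:~R + e * q%:~R ^+ 2.
set N := (X in X ^+ 2 <= _) => hN.
have NE : N = B' ^+ 2 - d * n' by rewrite /N /B' /n'; ring.
pose w := zmx R g *m zmx R (cv3 0 p q); pose u := zmx R g *m cv3 1 0 0.
have du : d = qf S u by rewrite qf_mul qf_col0.
have Bw : B' = bf S u w.
  by rewrite bf_mul -/T zmx_cv3 bf_e1.
have nw : n' = qf S w by rewrite qf_mul -/T zmx_cv3 qf_cv3// /ternary /n' /n /b /e; ring.
pose a := u o0 0.
have a0 : a != 0.
  apply/eqP => a0; have : 0 <= d.
    rewrite du qf_diag3 -/a a0; have := sqr_ge0 (u o1 0); have := sqr_ge0 (u o2 0).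
    nra.
  by rewrite leNgt T0.
(* The vector [w_0 u - a w] of the plane has coordinates [(0, Y, Z)], where the form is positive,
   while it is negative at [u]. The plane is thus indefinite, which is [N > 0]. *)
pose Y := w o0 0 * u o1 0 - a * w o1 0; pose Z := w o0 0 * u o2 0 - a * w o2 0.
have NYZ : N * a ^+ 2 = (d * w o0 0 - B' * a) ^+ 2 - d * (c2 * Y ^+ 2 + c3 * Z ^+ 2).
  by rewrite NE Bw nw du !qf_diag3 bf_diag3 /Y /Z /a; ring.
have YZ : 0 < c2 * Y ^+ 2 + c3 * Z ^+ 2.
  have Y0 : 0 <= c2 * Y ^+ 2 by rewrite mulr_ge0 ?sqr_ge0// ltW.
  have Z0 : 0 <= c3 * Z ^+ 2 by rewrite mulr_ge0 ?sqr_ge0// ltW.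
  rewrite lt_neqAle addr_ge0// andbT eq_sym; apply/eqP => /eqP.
  rewrite paddr_eq0// !mulf_eq0 (gt_eqF c2p) (gt_eqF c3p) /= !orbb.
  move=> /andP[/eqP hY /eqP hZ].
  have : w o0 0 *: u - a *: w = 0.
    apply/matrixP => i j; rewrite [j]ord1 lincomb_entry [RHS]mxE; move: i.
    by apply: ord3_ind => //; rewrite /a mulrC subrr.
  have -> : w o0 0 *: u - a *: w =
      zmx R g *m cv3 (w o0 0) (- a * p%:~R) (- a * q%:~R).
    set W := w o0 0; rewrite /u /w zmx_cv3 !scalemxAr -mulmxBr.
    congr (_ *m _); apply/matrixP => i j.
    rewrite [j]ord1 lincomb_entry; move: i (a) W => + x y.
    by apply: ord3_ind; rewrite !mxE /=; ring.
  move/(congr1 (mulmx (zmx R (invmx g)))); rewrite mulmxA zmxVK// mul1mx mulmx0.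
  move=> /matrixP hcv.
  have := hcv o1 0; have := hcv o2 0; rewrite !mxE /= => /eqP + /eqP.
  rewrite !mulf_eq0 oppr_eq0 (negPf a0) /= !intr_eq0 => /eqP q0 /eqP p0.
  by move: hb; rewrite p0 q0 !mul0r subr0 => /eqP.
have a20 : 0 < a ^+ 2 by rewrite exprn_even_gt0.
have N0 : 0 < N.
  rewrite -(pmulr_lgt0 _ a20) NYZ.
  have := sqr_ge0 (d * w o0 0 - B' * a).
  have : 0 < - d * (c2 * Y ^+ 2 + c3 * Z ^+ 2) by apply: mulr_gt0; rewrite /d; lra.
  lra.
have NK : N <= K.
  have hd : - d * - \det S < K ^+ 2 / 4.
    have h3 : - d < K ^+ 2 / (4 * - \det S) by rewrite /d; lra.
    by move: h3; rewrite ltr_pdivlMr; lra.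
  have : N ^+ 2 <= K ^+ 2 by lra.
  by rewrite ler_sqr// nnegrE ltW.
have [||x [y hxy]] := @binary_crossing R m d B' n' m0.
- by rewrite /d; apply/andP; split=> //; lra.
- by rewrite -NE N0 NK.
apply: (avoid (g *m (cv3 x (y * p) (y * q)))).
rewrite zmxM qf_mul -/T zmx_cv3 qf_cv3// /ternary !intrM.
move: hxy; rewrite -/d -/B -/n -/al -/b -/e /B' /n'.
set X1 := (X in 0 < X < _); set X2 := (X in _ -> is_true (0 < X < _)).
by have -> : X2 = X1 by rewrite /X1 /X2; ring.
Qed.

End DiagonalForms.

(** * Reduction of ternary forms *)

Section Reduction.
Variable R : realType.

(** Centring [x] costs at most [d / 4], so near-minimality of [d] gives [a' >= 11 / 16 * d ^+ 2] for
    the reduced coefficient [a'] of the binary form left after completing the square. With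
    [a' ^+ 2 <= 4 * (d * D)] this bounds [d], hence [a'], and through the determinant also [c']. *)
Lemma ternary_reduction (e0 D : R) : 0 < e0 -> 0 < D ->
  exists2 C : R, 1 <= C & forall d B n al b e : R, e0 <= d ->
  (d * n - B ^+ 2) * (d * e - al ^+ 2) - (d * b - B * al) ^+ 2 = d * D ->
  (forall x y z : int, [|| x != 0, y != 0 | z != 0] ->
     15 / 16 * d <= ternary d B n al b e x%:~R y%:~R z%:~R) ->
  exists p q r s x y : int, [/\ p * s - q * r = 1, d <= C,
    ternary d B n al b e x%:~R p%:~R q%:~R <= C &
    ternary d B n al b e y%:~R r%:~R s%:~R <= C].
Proof.
move=> e00 D0.
(* [D1], [A1] and [C1] bound [d], [a'] and [c'] from above; [a0] bounds [a'] from below. *)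
pose D1 := 9 * D + 1; pose A1 := 4 * D1 * D + 1; pose a0 := 11 / 16 * e0 ^+ 2.
pose C1 := (A1 ^+ 2 + D1 * D) / a0.
have D10 : 1 <= D1 by rewrite /D1; lra.
have D1D : 0 < D1 * D by apply: mulr_gt0 => //; lra.
have A10 : 1 <= A1 by rewrite /A1; lra.
have a00 : 0 < a0 by rewrite /a0; have := exprn_gt0 2 e00; lra.
have C10 : 0 < C1 by apply: divr_gt0 => //; have := sqr_ge0 A1; lra.
have f1 : 0 < (A1 + D1 ^+ 2) / e0.
  by apply: divr_gt0 => //; have := sqr_ge0 D1; lra.
have f2 : 0 < (C1 + D1 ^+ 2) / e0.
  by apply: divr_gt0 => //; have := sqr_ge0 D1; lra.
exists (D1 + (A1 + D1 ^+ 2) / e0 + (C1 + D1 ^+ 2) / e0); first lra.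
move=> d B n al b e e0d det min.
have d0 : 0 < d by lra.
have dD : 0 < d * D by apply: mulr_gt0.
have [|p [q [r [s [hb [ha hb']]]]]] :=
  @binary_reduction R (d * n - B ^+ 2) (d * b - B * al) (d * e - al ^+ 2).
  by rewrite det gt_eqF.
move: ha hb'; rewrite det (gtr0_norm dD); set a' := (X in X ^+ 2 <= _).
set b' := (X in 2 * `|X|) => ha hb'.
pose c' := (d * n - B ^+ 2) * r%:~R ^+ 2
  + 2 * (d * b - B * al) * r%:~R * s%:~R + (d * e - al ^+ 2) * s%:~R ^+ 2.
have hbR : (p%:~R * s%:~R - q%:~R * r%:~R : R) = 1.
  by rewrite -!intrM -intrB hb.
have hdet : a' * c' - b' ^+ 2 = d * D.
  by rewrite -det -[RHS]mulr1 -(expr1n _ 2) -hbR /a' /b' /c'; ring.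
have centre (u v : int) : exists x : int,
    (x%:~R * d + u%:~R * B + v%:~R * al) ^+ 2 <= d ^+ 2 / 4.
  have [x /andP[x1 x2]] :=
    int_translate_itv (1 / 2 - (u%:~R * B + v%:~R * al) / d).
  exists x; have -> : x%:~R * d + u%:~R * B + v%:~R * al =
     (x%:~R + (u%:~R * B + v%:~R * al) / d) * d.
    by field; rewrite gt_eqF.
  rewrite exprMn mulrC ler_pM2l ?exprn_gt0//.
  set t := _ + _; have [t1 t2] : - (1 / 2) <= t /\ t <= 1 / 2.
    by rewrite /t; split; lra.
  nra.
have [x hx] := centre p q; have [y hy] := centre r s.
have tx : d * ternary d B n al b e x%:~R p%:~R q%:~R =
    (x%:~R * d + p%:~R * B + q%:~R * al) ^+ 2 + a'.
  by rewrite /ternary /a'; ring.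
have ty : d * ternary d B n al b e y%:~R r%:~R s%:~R =
    (y%:~R * d + r%:~R * B + s%:~R * al) ^+ 2 + c'.
  by rewrite /ternary /c'; ring.
have pq : [|| x != 0, p != 0 | q != 0].
  apply: contraT; rewrite !negb_or !negbK => /and3P[_ /eqP p0 /eqP q0].
  by move/eqP: hb; rewrite p0 q0 !mul0r subr0.
have := min _ _ _ pq; rewrite -(ler_pM2l d0) tx => a'l.
have d2 : 0 < d ^+ 2 by rewrite exprn_gt0.
have a'd : 11 / 16 * d ^+ 2 <= a' by lra.
have a'0 : 0 < a' by lra.
have dD1 : d <= D1.
  have h1 : (11 / 16 * d ^+ 2) ^+ 2 <= 4 * (d * D).
    apply: le_trans ha; rewrite ler_sqr ?nnegrE; lra.
  have h2 : 121 / 256 * d ^+ 3 <= 4 * D.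
    by rewrite -(ler_pM2l d0); move: h1; lra.
  rewrite leNgt; apply/negP => h3.
  have : d ^+ 1 <= d ^+ 3 by apply: ler_weXn2l => //; lra.
  rewrite expr1.
  by rewrite /D1 in h3 *; lra.
have d2D1 : d ^+ 2 <= D1 ^+ 2 by rewrite ler_sqr ?nnegrE; lra.
have dDD : d * D <= D1 * D by rewrite ler_pM2r.
have a'A : a' <= A1.
  rewrite leNgt; apply/negP => h3; have : A1 <= A1 * a'.
    by apply: ler_peMr; lra.
  have : A1 * a' <= a' ^+ 2 by rewrite expr2 ler_pM2r// ltW.
  by rewrite /A1 in h3 *; lra.
have a0a : a0 <= a'.
  apply: le_trans a'd; rewrite /a0.
  have : e0 ^+ 2 <= d ^+ 2 by rewrite ler_sqr ?nnegrE; lra.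
  lra.
have c'C : c' <= C1.
  rewrite /C1 ler_pdivlMr//.
  have b'2 : b' ^+ 2 <= a' ^+ 2 / 4.
    have := hb' (lt0r_neq0 a'0); rewrite (gtr0_norm a'0) => h.
    rewrite -[b' ^+ 2](@real_normK _ b') ?num_real//.
    have h' : `|b'| ^+ 2 <= (a' / 2) ^+ 2 by rewrite ler_sqr ?nnegrE//; lra.
    lra.
  have a2A : a' ^+ 2 <= A1 ^+ 2 by rewrite ler_sqr ?nnegrE; lra.
  have a'c' : a' * c' <= A1 ^+ 2 + D1 * D by have := sqr_ge0 A1; lra.
  have [c0|c0] := lerP c' 0.
    have : c' * a0 <= 0 by rewrite mulr_le0_ge0// ltW.
    have := sqr_ge0 A1; lra.
  have : a0 * c' <= a' * c' by rewrite ler_pM2r.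
  lra.
have bd (T X : R) : d * T <= X -> 0 <= X -> T <= X / e0.
  move=> h X0; rewrite ler_pdivlMr//.
  have [T0|T0] := lerP T 0.
    by apply: le_trans X0; rewrite mulr_le0_ge0// ltW.
  by apply: le_trans h; rewrite mulrC ler_pM2r.
have D12 := sqr_ge0 D1.
exists p, q, r, s, x, y; split=> //; first lra.
  have : ternary d B n al b e x%:~R p%:~R q%:~R <= (A1 + D1 ^+ 2) / e0.
    by apply: bd; rewrite ?tx; lra.
  lra.
have : ternary d B n al b e y%:~R r%:~R s%:~R <= (C1 + D1 ^+ 2) / e0.
  by apply: bd; rewrite ?ty; lra.
lra.
Qed.

End Reduction.

Section Basis.
Variable R : realType.

(** A quantitative Mahler criterion: the primitive part of a near-shortest vector starts the basis,
    and [ternary_reduction] completes it. *)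
Lemma bounded_basis (e0 d0 : R) : 0 < e0 -> 0 < d0 ->
  exists2 C : R, 1 <= C & forall z : 'M[R]_3, \det z = d0 ->
  (forall v : 'cV[int]_3, v != 0 -> e0 <= qf (z^T *m z) (zmx R v)) ->
  exists2 g : 'M[int]_3, SLz g & forall i j, `|(z *m zmx R g) i j| <= C.
Proof.
move=> e00 d00; have D0 : 0 < d0 ^+ 2 by rewrite exprn_gt0.
have [C C1 H] := ternary_reduction e00 D0.
exists C => // z dz zmin; pose G := z^T *m z.
have sG : G^T = G by rewrite trmx_mul trmxK.
have [|v v0 vmin] := near_inf (P := fun v : 'cV[int]_3 => v != 0) e00 _ zmin.
  exists (cv3 1 0 0); apply/eqP => /matrixP /(_ o0 0).
  by rewrite !mxE.
have [g [k [sg k0 vE]]] := primitive_basis v0.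
pose T := (zmx R g)^T *m G *m zmx R g.
have sT : T^T = T by apply: sym_conj.
have dT : \det T = d0 ^+ 2.
  by rewrite /T /G !det_mulmx !det_tr det_zmx sg dz; ring.
have vT : qf G (zmx R v) = k%:~R ^+ 2 * T o0 o0.
  have -> : zmx R v = k%:~R *: zmx R (col o0 g).
    by rewrite vE; apply/matrixP => i j; rewrite !mxE intrM.
  by rewrite qfZ col0E qf_mul qf_col0.
have k1 := intr_sqr_ge1 R k0.
have gn0 (w : 'cV[int]_3) : w != 0 -> g *m w != 0.
  move=> w0; apply: contraNneq w0 => /(congr1 (mulmx (invmx g))).
  by rewrite mulmxA mulVmx ?SLz_unit// mul1mx mulmx0 => ->.
have T00 : e0 <= T o0 o0.
  have -> : T o0 o0 = qf G (zmx R (col o0 g)) by rewrite col0E qf_mul qf_col0.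
  apply: zmin; apply: contraNneq v0 => h.
  by rewrite vE h scaler0.
have Tv : T o0 o0 <= qf G (zmx R v) by rewrite vT; nra.
have s01 : T o1 o0 = T o0 o1 by rewrite -{1}sT mxE.
have s02 : T o2 o0 = T o0 o2 by rewrite -{1}sT mxE.
have s12 : T o2 o1 = T o1 o2 by rewrite -{1}sT mxE.
have qT (x y w : int) : qf G (zmx R (g *m cv3 x y w)) =
    ternary (T o0 o0) (T o0 o1) (T o1 o1) (T o0 o2) (T o1 o2) (T o2 o2)
      x%:~R y%:~R w%:~R.
  by rewrite zmxM qf_mul -/T zmx_cv3 qf_cv3.
have [|||p [q [r [s [x [y [hb h0 h1 h2]]]]]]] := H (T o0 o0) (T o0 o1) (T o1 o1)
  (T o0 o2) (T o1 o2) (T o2 o2).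
- exact: T00.
- by rewrite -dT det3 s01 s02 s12; ring.
- move=> x y w hxyw; rewrite -qT.
  have : 15 / 16 * qf G (zmx R v) <= qf G (zmx R (g *m cv3 x y w)).
    apply: vmin; apply: gn0; apply: contraTneq hxyw => /matrixP h.
    have := h o0 0; have := h o1 0; have := h o2 0.
    by rewrite !mxE /= => -> -> ->.
  lra.
pose P : 'M[int]_3 := mx3 1 x y 0 p r 0 q s.
have sP : SLz P by rewrite /SLz det3 !mxE /= -[RHS]hb; ring.
exists (g *m P); first exact: SLzM.
have colP (j : 'I_3) (a b c : int) : col j P = cv3 a b c ->
    qf G (zmx R (g *m cv3 a b c)) <= C ->
    forall i, `|(z *m zmx R (g *m P)) i j| <= C.
  move=> hj hC i; set A := z *m _.
  have AE l : A l j = (z *m zmx R (g *m cv3 a b c)) l 0.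
    rewrite -hj /A !zmxM !mulmxA; move: (z *m zmx R g) => Z.
    by rewrite !mulmx3 !mxE.
  move: hC; rewrite /qf /G mulmxA -trmx_mul -mulmxA.
  set X := z *m _ in AE *; rewrite mulmx3 ![X^T _ _]mxE -!AE => hC.
  have hi : A i j ^+ 2 <= C.
    have p0 := sqr_ge0 (A o0 j); have p1 := sqr_ge0 (A o1 j).
    have p2 := sqr_ge0 (A o2 j); move: i.
    by apply: ord3_ind; lra.
  have : `|A i j| ^+ 2 <= C ^+ 2.
    by rewrite real_normK ?num_real//; apply: le_trans hi _; nra.
  by rewrite ler_sqr ?nnegrE//; lra.
move=> i; apply: ord3_ind; move: i.
- apply: (@colP o0 1 0 0).
    by apply/matrixP => i j; rewrite [j]ord1 !mxE; move: i; apply: ord3_ind.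
  have -> : qf G (zmx R (g *m cv3 1 0 0)) = T o0 o0.
    by rewrite qT /ternary; ring.
  exact: h0.
- apply: (@colP o1 x p q); last by rewrite qT.
  by apply/matrixP => i j; rewrite [j]ord1 !mxE; move: i; apply: ord3_ind.
- apply: (@colP o2 y r s); last by rewrite qT.
  by apply/matrixP => i j; rewrite [j]ord1 !mxE; move: i; apply: ord3_ind.
Qed.

End Basis.

(** * Limits along an ultrafilter *)

Section Limits.
Variable R : realType.
Variable U : set_system nat.
Hypothesis UU : UltraFilter U.
Hypothesis Uoo : \oo `<=` U.

Definition mcvg (X : nat -> 'M[R]_3) (L : 'M[R]_3) :=
  forall i j, (fun n => X n i j) @ U --> L i j.

(** Compactness of [[- C, C]] applied to the image ultrafilter; limits can thus be taken without
    extracting subsequences. *)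
Lemma ucvg_bounded (x : nat -> R) (C : R) : (forall n, `|x n| <= C) ->
  exists l : R, x @ U --> l.
Proof.
move=> xC.
have := @segment_compact R (- C) C; rewrite compact_ultra => /(_ (x @ U)).
have UxU : UltraFilter (x @ U).
  split; first exact: fmap_proper_filter.
  move=> G PG xG; rewrite eqEsubset; split=> // A GA.
  have [UA|UA] := in_ultra_setVsetC (x @^-1` A) UU; first exact: UA.
  have GnA : G (~` A) by apply: xG.
  have := filterI GA GnA; rewrite setICr => G0.
  exfalso; apply: (@filter_not_empty _ G PG); apply: G0.
case/(_ UxU).
  have : U (x @^-1` `[- C, C]%classic); last by [].
  by apply: filterE => n; rewrite /preimage /= in_itv /= -ler_norml.
by move=> l [_ xl]; exists l.
Qed.

Lemma mcvg_bounded (X : nat -> 'M[R]_3) (C : R) :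
  (forall n i j, `|X n i j| <= C) -> exists L, mcvg X L.
Proof.
move=> XC.
have H i j : exists l : R, (fun n => X n i j) @ U --> l by apply: (@ucvg_bounded _ C).
have [f hf] := choice (fun ij : 'I_3 * 'I_3 => H ij.1 ij.2).
by exists (\matrix_(i, j) f (i, j)) => i j; rewrite mxE; apply: (hf (i, j)).
Qed.

Lemma mcvg_cst A : mcvg (fun=> A) A.
Proof. by move=> i j; apply: cvg_cst. Qed.

Lemma mcvgM X Y A B : mcvg X A -> mcvg Y B -> mcvg (fun n => X n *m Y n) (A *m B).
Proof.
move=> XA YB i j; rewrite mulmx3.
under eq_fun do rewrite mulmx3.
by apply: cvgD; [apply: cvgD|]; apply: cvgM; [apply: XA|apply: YB
  |apply: XA|apply: YB|apply: XA|apply: YB].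
Qed.

Lemma mcvgT X A : mcvg X A -> mcvg (fun n => (X n)^T) A^T.
Proof. by move=> XA i j; under eq_fun do rewrite mxE; rewrite mxE; apply: XA. Qed.

Lemma mcvg_conj X A Y B : mcvg X A -> mcvg Y B ->
  mcvg (fun n => (X n)^T *m Y n *m X n) (A^T *m B *m A).
Proof. by move=> XA YB; apply: mcvgM => //; apply: mcvgM => //; apply: mcvgT. Qed.

Lemma mcvg_det X A : mcvg X A -> (fun n => \det (X n)) @ U --> \det A.
Proof.
move=> XA; rewrite det3; under eq_fun do rewrite det3.
by apply: cvgD; [apply: cvgB|]; apply: cvgM; try apply: cvgB;
  try apply: cvgM; apply: XA.
Qed.

Lemma mcvg_qf X A v : mcvg X A -> (fun n => qf (X n) v) @ U --> qf A v.
Proof.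
move=> XA; rewrite /qf mulmx3 !mulmx3.
under eq_fun do rewrite mulmx3 !mulmx3.
by apply: cvgD; [apply: cvgD|]; apply: cvgM; try exact: cvg_cst;
  (apply: cvgD; [apply: cvgD|]); apply: cvgM; try exact: cvg_cst; apply: XA.
Qed.

Lemma ucvg_unique (x : nat -> R) (a b : R) : x @ U --> a -> x @ U --> b -> a = b.
Proof. by move=> xa xb; apply: (cvg_unique _ xa xb). Qed.

Lemma ucvg_ge (x : nat -> R) (a m : R) : x @ U --> a -> (forall n, m <= x n) -> m <= a.
Proof.
move=> xa mx; rewrite leNgt; apply/negP => am.
have ma : 0 < m - a by lra.
have /cvgrPdist_lt /(_ _ ma) := xa => /filter_ex[n].
by rewrite ltr_norml; have := mx n; lra.
Qed.

Definition nearmx (S T : 'M[R]_3) (e : R) := forall i j, `|S i j - T i j| < e.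

Lemma mcvg_near X A e : 0 < e -> mcvg X A -> U [set n | nearmx (X n) A e].
Proof.
move=> e0 XA.
have H i j : U [set n | `|X n i j - A i j| < e].
  have /cvgrPdist_lt /(_ _ e0) := XA i j; apply: filterS => n /=.
  by rewrite distrC.
have Hi i : U [set n | forall j, `|X n i j - A i j| < e].
  apply: filterS (filterI (H i o0) (filterI (H i o1) (H i o2))) => n [h0 [h1 h2]].
  by apply: ord3_ind.
apply: filterS (filterI (Hi o0) (filterI (Hi o1) (Hi o2))) => n [h0 [h1 h2]].
by apply: ord3_ind.
Qed.

Lemma near_mcvg X A : (forall n, nearmx (X n) A n.+1%:R^-1) -> mcvg X A.
Proof.
move=> XA i j; apply/cvgrPdist_lt => e e0.
apply: Uoo; exists (Num.bound e^-1) => // n /= hn.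
rewrite distrC; apply: lt_trans (XA n i j) _.
have ei0 : 0 <= e^-1 by rewrite invr_ge0 ltW.
have h : e^-1 < n.+1%:R.
  by apply: lt_le_trans (archi_boundP ei0) _; rewrite ler_nat ltnW.
by rewrite -[e]invrK ltf_pV2 ?posrE ?ltr0n ?invr_gt0.
Qed.

Lemma near_seq (P : 'M[R]_3 -> Prop) A :
  (forall e, 0 < e -> exists2 S, P S & nearmx S A e) ->
  exists2 S : nat -> 'M[R]_3, (forall n, P (S n)) & mcvg S A.
Proof.
move=> H.
have Hn (n : nat) : exists S, P S /\ nearmx S A n.+1%:R^-1.
  by have [|S PS SA] := H n.+1%:R^-1; [rewrite invr_gt0 | exists S].
have [S hS] := choice Hn.
by exists S; [move=> n; case: (hS n) | apply: near_mcvg => n; case: (hS n)].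
Qed.

Lemma ultra_unbounded (A : set nat) (N : nat) : U A -> exists2 n, A n & (N <= n)%N.
Proof.
move=> UA; have UN : U [set n | (N <= n)%N] by apply: Uoo; exists N.
by have [n [An Nn]] := filter_ex (filterI UA UN); exists n.
Qed.

End Limits.

(** * Frames of the form [2 x z + y ^ 2] *)

Section Frames.
Variable R : realType.

(* The Gram matrix of [2 x z + y ^ 2 + b z ^ 2]. *)
Definition Jb (b : R) : 'M[R]_3 := mx3 0 0 1 0 1 0 1 0 b.

(** It fixes the last coordinate, and so preserves every [Jb b] and not only [Jb 0]. *)
Definition unip (t : R) : 'M[R]_3 := mx3 1 (- t) (- (t ^+ 2 / 2)) 0 1 t 0 0 1.

Definition frame_form (b : R) (z : 'M[R]_3) : 'M[R]_3 := z^T *m Jb b *m z.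

Definition zconj (S : 'M[R]_3) (g : 'M[int]_3) := (zmx R g)^T *m S *m zmx R g.

Definition gap_form (m D : R) (S : 'M[R]_3) := [/\ S^T = S, \det S = D &
  forall v : 'cV[int]_3, v != 0 -> m <= `|qf S (zmx R v)|].

(** The columns of [z] span the lattice; [- d ^+ 2] arises because [Jb 0] has determinant [-1]. *)
Definition frame (m d : R) (z : 'M[R]_3) :=
  \det z = d /\ gap_form m (- d ^+ 2) (frame_form 0 z).

Lemma sym_Jb b : (Jb b)^T = Jb b.
Proof. by apply/matrixP; apply: ord3_ind; apply: ord3_ind; rewrite !mxE. Qed.

Lemma unip_Jb b t : (unip t)^T *m Jb b *m unip t = Jb b.
Proof.
by apply/matrixP; apply: ord3_ind; apply: ord3_ind; rewrite !mulmx3 !mxE /=; field.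
Qed.

Lemma det_unip t : \det (unip t) = 1.
Proof. by rewrite det3 !mxE /=; ring. Qed.

Lemma unipD s t : unip s *m unip t = unip (s + t).
Proof.
by apply/matrixP; apply: ord3_ind; apply: ord3_ind; rewrite !mulmx3 !mxE /=; field.
Qed.

Lemma row2_neq0 (z : 'M[R]_3) : \det z != 0 -> exists j, z o2 j != 0.
Proof.
move=> dz; apply: contrapT => hn; have z0 j : z o2 j = 0.
  by apply: contrapT => /eqP h; apply: hn; exists j.
by move: dz; rewrite det3 !z0 !mulr0 !subrr !mulr0 subrr add0r eqxx.
Qed.

Lemma unip0 : unip 0 = 1%:M.
Proof.
by apply/matrixP; apply: ord3_ind; apply: ord3_ind; rewrite !mxE /= ?mulr0n //; field.
Qed.

Lemma frame_form_unip b t z : frame_form b (unip t *m z) = frame_form b z.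
Proof. by rewrite /frame_form trmx_mul !mulmxA -2!(mulmxA z^T) unip_Jb. Qed.

Lemma frame_form_conj b z g : frame_form b (z *m zmx R g) = zconj (frame_form b z) g.
Proof. by rewrite /frame_form /zconj trmx_mul !mulmxA. Qed.

Lemma det_zconj S g : SLz g -> \det (zconj S g) = \det S.
Proof. by move=> sg; rewrite !det_mulmx det_tr det_zmx sg; ring. Qed.

Lemma zconjM S g h : zconj S (g *m h) = zconj (zconj S g) h.
Proof. by rewrite /zconj zmxM trmx_mul !mulmxA. Qed.

Lemma zconjK S g : SLz g -> zconj (zconj S g) (invmx g) = S.
Proof.
by move=> sg; rewrite -zconjM mulmxV ?SLz_unit// /zconj zmx1 trmx1 mul1mx mulmx1.
Qed.

Lemma SLz_mul_neq0 (g : 'M[int]_3) (v : 'cV_3) : SLz g -> v != 0 -> g *m v != 0.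
Proof.
move=> sg w0; apply: contraNneq w0 => /(congr1 (mulmx (invmx g))).
by rewrite mulmxA mulVmx ?SLz_unit// mul1mx mulmx0 => ->.
Qed.

Lemma gap_form_conj m D S g : SLz g -> gap_form m D S -> gap_form m D (zconj S g).
Proof.
move=> sg [sS dS mS]; split; first exact: sym_conj.
  by rewrite det_zconj.
move=> v v0; rewrite -qf_mul -zmxM; apply: mS; exact: SLz_mul_neq0.
Qed.

Lemma frame_unip m d t z : frame m d z -> frame m d (unip t *m z).
Proof.
by move=> [dz Fz]; split; rewrite ?frame_form_unip// det_mulmx det_unip mul1r.
Qed.

Lemma frame_conj m d g z : SLz g -> frame m d z -> frame m d (z *m zmx R g).
Proof.
move=> sg [dz Fz]; split; first by rewrite det_mulmx det_zmx sg mulr1.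
by rewrite frame_form_conj; apply: gap_form_conj.
Qed.

Lemma qf_Jb b (x : 'cV[R]_3) : qf (Jb b) x =
  2 * x o0 0 * x o2 0 + x o1 0 ^+ 2 + b * x o2 0 ^+ 2.
Proof. by rewrite /qf !mulmx3 !mxE /=; ring. Qed.

Lemma qf_frame_form b z x : qf (frame_form b z) x = qf (Jb b) (z *m x).
Proof. by rewrite qf_mul. Qed.

(** As [|2 * x * w + y ^+ 2| <= x ^+ 2 + y ^+ 2 + w ^+ 2], the gap bounds Euclidean lengths from
    below and [bounded_basis] applies. *)
Lemma frame_basis m d : 0 < m -> 0 < d ->
  exists2 C : R, 1 <= C & forall z, frame m d z ->
  exists2 g : 'M[int]_3, SLz g & forall i j, `|(z *m zmx R g) i j| <= C.
Proof.
move=> m0 d0; have [C C1 H] := bounded_basis m0 d0.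
exists C => // z [dz [_ _ Fz]]; apply: H => // v /Fz; rewrite qf_frame_form qf_Jb.
have -> : qf (z^T *m z) (zmx R v) = (z *m zmx R v) o0 0 ^+ 2
   + (z *m zmx R v) o1 0 ^+ 2 + (z *m zmx R v) o2 0 ^+ 2.
  rewrite /qf mulmxA -trmx_mul -mulmxA; move: (z *m _) => x.
  by rewrite mulmx3 !mxE; ring.
move: ((z *m _) o0 0) ((z *m _) o1 0) ((z *m _) o2 0) => x y w h.
apply: le_trans h _; rewrite mul0r addr0 ler_norml.
have := sqr_ge0 (x - w); have := sqr_ge0 (x + w); have := sqr_ge0 y.
by move=> h1 h2 h3; apply/andP; split; lra.
Qed.

Lemma frame_covering m d : 0 < m -> 0 < d ->
  exists2 C : R, 1 <= C & forall z, frame m d z ->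
  forall x : 'cV[R]_3, exists v : 'cV[int]_3,
    forall i, `|(z *m zmx R v) i 0 - x i 0| <= C.
Proof.
move=> m0 d0; have [C C1 H] := frame_basis m0 d0.
exists (3 * C); first lra.
move=> z fz x; have [g sg gC] := H z fz.
pose A := z *m zmx R g.
have uA : A \in unitmx.
  by rewrite unitmxE det_mulmx det_zmx sg mulr1 fz.1 unitfE gt_eqF.
pose y := invmx A *m x.
pose v := \col_i Num.floor (y i 0).
exists (g *m v) => i.
have -> : (z *m zmx R (g *m v)) i 0 - x i 0 = (A *m (zmx R v - y)) i 0.
  by rewrite mulmxBr /y mulmxA mulmxV// mul1mx zmxM mulmxA !mxE.
have hv j : `|(zmx R v - y) j 0| <= 1.
  have -> : (zmx R v - y) j 0 = (Num.floor (y j 0))%:~R - y j 0.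
    by rewrite mxE zmxE [v _ _]mxE [(- y) _ _]mxE.
  have := floor_itv (y j 0); rewrite intrD => /andP[h1 h2].
  by rewrite ler_norml; lra.
rewrite mulmx3.
have hC j : `|A i j * (zmx R v - y) j 0| <= C.
  by rewrite normrM -[leRHS]mulr1 ler_pM.
apply: le_trans (ler_normD _ _) _.
have h3 := ler_normD (A i o0 * (zmx R v - y) o0 0) (A i o1 * (zmx R v - y) o1 0).
by have := hC o0; have := hC o1; have := hC o2; lra.
Qed.

(** A step of length at most [m] cannot jump over the gap [(- m, m)], so the sign persists. *)
Lemma discrete_ivt (m : R) (f : nat -> R) (N : nat) : 0 < m ->
  (forall i, (i < N)%N -> `|f i.+1 - f i| <= m) ->
  (forall i, (i <= N)%N -> m <= `|f i|) -> f 0%N <= 0 -> f N < 0.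
Proof.
move=> m0 fstep fN f0.
have neg i : (i <= N)%N -> f i <= 0 -> f i <= - m.
  by move=> /fN h fi; move: h; rewrite ler0_norm//; lra.
suff H : forall i, (i <= N)%N -> f i <= 0 by have := neg N (leqnn _) (H N (leqnn _)); lra.
elim=> [//|i IH] iN.
have := neg i (ltnW iN) (IH (ltnW iN)); have := fstep i iN.
by rewrite ler_norml => /andP[h1 h2]; lra.
Qed.

(** The covering radius supplies a lattice point with last coordinate [w] in [[1, L]] and first
    coordinate near [X] or [- X]. The value there has opposite signs at [b 0] and at [b N], while
    consecutive parameters change it by at most [m], against [discrete_ivt]. *)
Lemma no_chain m d : 0 < m -> 0 < d ->
  exists2 S : R, 0 < S & exists2 eta : R, 0 < eta &
  forall z, frame m d z -> forall (b : nat -> R) (N : nat), `|b 0%N| <= 1 ->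
    (forall i, (i < N)%N -> `|b i.+1 - b i| <= eta) -> S <= `|b N| ->
    (forall i, (i <= N)%N -> gap_form m (- d ^+ 2) (frame_form (b i) z)) -> False.
Proof.
move=> m0 d0; have [C C1 H] := frame_covering m0 d0.
(* Then [|x| >= X - L = L ^+ 2], so the term [2 * x * w] decides the sign at [b 0] against [y ^+ 2]
   and [b 0 * w ^+ 2]. *)
pose L := 2 * C + 1; pose X := L + L ^+ 2.
have L1 : 1 <= L by rewrite /L; lra.
have L2 : 1 <= L ^+ 2 by rewrite expr2; nra.
have LX : 0 < L * (X + L) by rewrite mulr_gt0 /X; lra.
exists (2 * (L * (X + L)) + L ^+ 2); first lra.
exists (m / L ^+ 2); first by apply: divr_gt0; lra.
move=> z fz b N b0 bs bN Fb.
have pt (s : R) : s ^+ 2 = 1 -> exists v : 'cV[int]_3, exists x y w : R,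
    [/\ v != 0, forall c, qf (frame_form c z) (zmx R v) = 2 * x * w + y ^+ 2 + c * w ^+ 2,
      `|x - s * X| <= L, y ^+ 2 <= L ^+ 2 & 1 <= w <= L].
  move=> s2; have [v hv] := H z fz (cv3 (s * X) 0 (C + 1)).
  exists v, ((z *m zmx R v) o0 0), ((z *m zmx R v) o1 0), ((z *m zmx R v) o2 0).
  have e0 : `|(z *m zmx R v) o0 0 - s * X| <= C by have := hv o0; rewrite [cv3 _ _ _ _ _]mxE.
  have e1 : `|(z *m zmx R v) o1 0| <= C.
    by have := hv o1; rewrite [cv3 _ _ _ _ _]mxE /= subr0.
  have e2 : `|(z *m zmx R v) o2 0 - (C + 1)| <= C.
    by have := hv o2; rewrite [cv3 _ _ _ _ _]mxE.
  have e2' : 1 <= (z *m zmx R v) o2 0 <= L.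
    by move: e2; rewrite ler_norml /L => /andP[h1 h2]; apply/andP; split; lra.
  split=> //.
  - apply: contraTneq e2' => ->; rewrite /zmx map_mx0 mulmx0 mxE.
    by apply/negP => /andP[h _]; lra.
  - by move=> c; rewrite qf_frame_form qf_Jb.
  - by rewrite /L; lra.
  - rewrite -[_ ^+ 2](@real_normK _ ((z *m zmx R v) o1 0)) ?num_real//.
    by rewrite ler_sqr ?nnegrE// /L; lra.
have sq1 w : 1 <= w <= L -> 1 <= w ^+ 2 <= L ^+ 2.
  by move=> /andP[h1 h2]; rewrite expr2; apply/andP; split; [nra|rewrite ler_sqr ?nnegrE; lra].
have step (w A : R) : 1 <= w <= L -> forall i, (i < N)%N ->
    `|(A + b i.+1 * w ^+ 2) - (A + b i * w ^+ 2)| <= m.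
  move=> hw i iN; have /andP[w1 w2] := sq1 _ hw.
  have -> : (A + b i.+1 * w ^+ 2) - (A + b i * w ^+ 2) =
    (b i.+1 - b i) * w ^+ 2 by ring.
  rewrite normrM (ger0_norm (sqr_ge0 w)).
  apply: le_trans (ler_pM _ _ (bs i iN) w2) _ => //; first exact: sqr_ge0.
  by rewrite divfK// gt_eqF//; lra.
move: b0; rewrite ler_norml => /andP[b01 b02].
have [bp|bn] := lerP 0 (b N).
  move: bN; rewrite ger0_norm// => bN.
  have [|v [x [y [w [v0 qv hx hy hw]]]]] := pt (-1); first by ring.
  have /andP[w1 w2] := hw; have /andP[w3 w4] := sq1 _ hw.
  move: hx; rewrite ler_norml => /andP[x1 x2]; have y0 := sqr_ge0 y.
  have xw1 : x * w <= - L ^+ 2 by rewrite /X in x2; nra.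
  have xw2 : - ((X + L) * L) <= x * w.
    have : 0 <= (x + (X + L)) * w by rewrite mulr_ge0//; lra.
    have : 0 <= (X + L) * (L - w) by rewrite mulr_ge0// /X; lra.
    lra.
  have := @discrete_ivt m (fun i => 2 * x * w + y ^+ 2 + b i * w ^+ 2) N m0.
  move=> /(_ (step w _ hw)) /= Hivt.
  have : 2 * x * w + y ^+ 2 + b N * w ^+ 2 < 0.
    apply: Hivt; first by move=> i iN; rewrite -qv; have [_ _] := Fb i iN; apply.
    have : b 0%N * w ^+ 2 <= 1 * L ^+ 2.
      have : b 0%N * w ^+ 2 <= 1 * w ^+ 2 by rewrite ler_wpM2r// sqr_ge0.
      lra.
    lra.
  have : b N * 1 <= b N * w ^+ 2 by rewrite ler_wpM2l.
  lra.
move: bN; rewrite ltr0_norm// => bN.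
have [|v [x [y [w [v0 qv hx hy hw]]]]] := pt 1; first by ring.
have /andP[w1 w2] := hw; have /andP[w3 w4] := sq1 _ hw.
move: hx; rewrite ler_norml => /andP[x1 x2]; have y0 := sqr_ge0 y.
have xw1 : L ^+ 2 <= x * w by rewrite /X in x1; nra.
have xw2 : x * w <= (X + L) * L.
  have : 0 <= ((X + L) - x) * w by rewrite mulr_ge0//; lra.
  have : 0 <= (X + L) * (L - w) by rewrite mulr_ge0// /X; lra.
  lra.
have := @discrete_ivt m (fun i => - (2 * x * w + y ^+ 2 + b i * w ^+ 2)) N m0.
have stepN i : (i < N)%N ->
    `|- (2 * x * w + y ^+ 2 + b i.+1 * w ^+ 2) -
      - (2 * x * w + y ^+ 2 + b i * w ^+ 2)| <= m.
  by move=> iN; rewrite -opprD normrN; apply: step.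
move=> /(_ stepN) /= Hivt.
have : - (2 * x * w + y ^+ 2 + b N * w ^+ 2) < 0.
  apply: Hivt; first by move=> i iN; rewrite normrN -qv; have [_ _] := Fb i iN; apply.
  have : - 1 * w ^+ 2 <= b 0%N * w ^+ 2 by rewrite ler_wpM2r// sqr_ge0.
  lra.
have : b N * w ^+ 2 <= b N * 1 by rewrite ler_wnM2l// ltW.
lra.
Qed.

End Frames.

(** * Limits of frames and of non-isolated forms *)

Section FrameLimits.
Variable R : realType.
Variable U : set_system nat.
Hypothesis UU : UltraFilter U.
Hypothesis Uoo : \oo `<=` U.

Lemma gap_form_lim m D (S : nat -> 'M[R]_3) L :
  (forall n, gap_form m D (S n)) -> mcvg U S L -> gap_form m D L.
Proof.
move=> FS SL; split.
- apply/matrixP => i j; rewrite mxE.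
  apply: (ucvg_unique UU (SL j i)).
  have -> : (fun n => S n j i) = (fun n => S n i j).
    apply/funext => n; have [sS _ _] := FS n.
    by rewrite -[in RHS]sS mxE.
  exact: SL.
- apply: (ucvg_unique UU (mcvg_det UU SL)).
  have -> : (fun n => \det (S n)) = (fun=> D) by apply/funext => n; case: (FS n).
  exact: cvg_cst.
- move=> v v0; apply: (@ucvg_ge R U UU (fun n => `|qf (S n) (zmx R v)|)).
    by apply: cvg_norm; apply: mcvg_qf.
  by move=> n; have [_ _] := FS n; apply.
Qed.

Lemma frame_form_lim b (Z : nat -> 'M[R]_3) z : mcvg U Z z ->
  mcvg U (fun n => frame_form b (Z n)) (frame_form b z).
Proof. by move=> Zz; apply: mcvg_conj => //; apply: mcvg_cst. Qed.

(** Integral base change brings all frames into a bounded set by [frame_basis], and gap and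
    determinant pass to the limit. *)
Lemma frame_limit m d (Z : nat -> 'M[R]_3) : 0 < m -> 0 < d ->
  (forall n, frame m d (Z n)) ->
  exists (g : nat -> 'M[int]_3) (z : 'M[R]_3), [/\ forall n, SLz (g n),
    mcvg U (fun n => Z n *m zmx R (g n)) z & frame m d z].
Proof.
move=> m0 d0 FZ; have [C C1 H] := frame_basis m0 d0.
have Hn n : exists g : 'M[int]_3, SLz g /\
    forall i j, `|(Z n *m zmx R g) i j| <= C.
  by have [g sg gC] := H _ (FZ n); exists g.
have [g hg] := choice Hn.
have [z hz] := mcvg_bounded UU (fun n => (hg n).2).
exists g, z; split=> //; first by move=> n; case: (hg n).
have fr n : frame m d (Z n *m zmx R (g n)).
  by apply: frame_conj => //; case: (hg n).
split.
  apply: (ucvg_unique UU (mcvg_det UU hz)).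
  have -> : (fun n => \det (Z n *m zmx R (g n))) = (fun=> d).
    by apply/funext => n; case: (fr n).
  exact: cvg_cst.
have Fn n : gap_form m (- d ^+ 2) (frame_form 0 (Z n *m zmx R (g n))) by case: (fr n).
by apply: gap_form_lim Fn _; apply: frame_form_lim.
Qed.

(* [f] is not isolated in [gap_form], and the nearby members of [gap_form] do not all
   lie on one line [f + b * k^T k]. *)
Definition nonlinear_limit (m D : R) (f : 'M[R]_3) := forall (k : 'rV[R]_3) (e : R), 0 < e ->
  exists S, [/\ gap_form m D S, nearmx S f e & forall b, S <> f + b *: (k^T *m k)].

Lemma conj_line (f : 'M[R]_3) g b (k : 'rV[R]_3) :
  zconj (f + b *: (k^T *m k)) g =
  zconj f g + b *: ((k *m zmx R g)^T *m (k *m zmx R g)).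
Proof.
by rewrite /zconj trmx_mul mulmxDr mulmxDl -scalemxAr -scalemxAl !mulmxA.
Qed.

Lemma nonlinear_limit_conj m D f g : SLz g -> nonlinear_limit m D f -> nonlinear_limit m D (zconj f g).
Proof.
move=> sg nlf k e e0; pose k' := k *m zmx R (invmx g).
have [|S hS Sf] := @near_seq R U UU Uoo
    (fun S => gap_form m D S /\ forall b, S <> f + b *: (k'^T *m k')) f.
  by move=> e' /(nlf k')[S [h1 h2 h3]]; exists S.
have Scf : mcvg U (fun n => zconj (S n) g) (zconj f g).
  by apply: mcvg_conj => //; apply: mcvg_cst.
have [n hn] := filter_ex (mcvg_near UU e0 Scf).
exists (zconj (S n) g); split=> //.
  by apply: gap_form_conj => //; case: (hS n).
move=> b /(congr1 (fun X => zconj X (invmx g))).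
by rewrite conj_line !zconjK// -/k'; case: (hS n) => _ /(_ b).
Qed.

(** Suppose all forms with the gap near [f'] lay on one line. Some [zconj f (g n)] is so close to
    [f'] that it is on this line together with its own neighbours, against the property of [f]
    transported by [g n]. *)
Lemma nonlinear_limit_lim m D f (g : nat -> 'M[int]_3) f' : gap_form m D f ->
  (forall n, SLz (g n)) -> mcvg U (fun n => zconj f (g n)) f' ->
  nonlinear_limit m D f -> nonlinear_limit m D f'.
Proof.
move=> Ff sg cf nlf k e e0; apply: contrapT => hn.
have line S : gap_form m D S -> nearmx S f' e -> exists b, S = f' + b *: (k^T *m k).
  move=> FS nS; apply: contrapT => hb; apply: hn; exists S; split=> // b hS.
  by apply: hb; exists b.
have e20 : 0 < e / 2 by lra.
have [n hnr] := filter_ex (mcvg_near UU e20 cf).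
have nw S : nearmx S (zconj f (g n)) (e / 2) -> nearmx S f' e.
  move=> h i j; have := h i j; have := hnr i j.
  rewrite !ltr_norml => /andP[h1 h2] /andP[h3 h4]; apply/andP; split; lra.
have [|bn hbn] := line _ (gap_form_conj (sg n) Ff).
  by apply: nw => i j; rewrite subrr normr0.
have [S [FS /nw nS Sb]] := nonlinear_limit_conj (sg n) nlf k e20.
have [b hb] := line _ FS nS.
apply: (Sb (b - bn)); by rewrite hbn hb -addrA -scalerDl addrCA subrr addr0.
Qed.

Lemma exists_scale (c1 c2 c3 c4 L : R) : 0 < L ->
  [|| c1 != 0, c2 != 0, c3 != 0 | c4 != 0] ->
  exists2 T : R, 0 < T &
    `|c1| * T + `|c2| * T ^+ 2 + `|c3| * T ^+ 3 + `|c4| * T ^+ 4 = L.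
Proof.
move=> L0 hc.
pose p : {poly R} := `|c1| *: 'X + `|c2| *: 'X^2 + `|c3| *: 'X^3
   + `|c4| *: 'X^4 - L%:P.
have pE x : p.[x] = `|c1| * x + `|c2| * x ^+ 2 + `|c3| * x ^+ 3
   + `|c4| * x ^+ 4 - L.
  by rewrite /p !hornerE.
pose s := `|c1| + `|c2| + `|c3| + `|c4|.
have s0 : 0 < s.
  have := normr_ge0 c1; have := normr_ge0 c2; have := normr_ge0 c3.
  have := normr_ge0 c4; rewrite /s.
  by case/or4P: hc; rewrite -normr_gt0; lra.
pose b := L / s + 1.
have b1 : 1 <= b by rewrite /b; have := divr_gt0 L0 s0; lra.
have [||T /andP[T0 _]] := @poly_ivt R p 0 b; first by lra.
- rewrite !pE expr0n /= !expr0n /= !mulr0 !addr0 add0r; apply/andP; split; first lra.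
  have mono k (c : R) : (0 < k)%N -> `|c| * b <= `|c| * b ^+ k.
    move=> k0; rewrite ler_wpM2l// -{1}(expr1 b).
    by apply: ler_weXn2l.
  have h2 := @mono 2%N c2 isT; have h3 := @mono 3%N c3 isT.
  have h4 := @mono 4%N c4 isT.
  have : s * b = L + s by rewrite /b; field; rewrite gt_eqF.
  rewrite /s in s0 *; lra.
rewrite rootE pE subr_eq0 => /eqP hT; exists T => //.
rewrite lt_neqAle T0 andbT; apply/eqP => T00.
by move: hT; rewrite -T00 !expr0n /= !mulr0 !addr0; lra.
Qed.

(** The values at [1/4], [1/2], [3/4] and [1] determine the coefficients: if all four are below [S],
    interpolation bounds each coefficient by [320 * S], and [4 * 320 < 1300]. *)
Lemma poly4_large (e1 e2 e3 e4 S : R) : 0 < S ->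
  1300 * S <= `|e1| + `|e2| + `|e3| + `|e4| ->
  exists2 th : R, 0 <= th <= 1 &
    S <= `|e1 * th + e2 * th ^+ 2 + e3 * th ^+ 3 + e4 * th ^+ 4|.
Proof.
move=> S0 hS; apply: contrapT => hn.
have small (th : R) : 0 <= th <= 1 ->
    `|e1 * th + e2 * th ^+ 2 + e3 * th ^+ 3 + e4 * th ^+ 4| < S.
  by move=> h; rewrite ltNge; apply/negP => h'; apply: hn; exists th.
have h1 : 0 <= (1 / 4 : R) <= 1 by apply/andP; split; lra.
have h2 : 0 <= (1 / 2 : R) <= 1 by apply/andP; split; lra.
have h3 : 0 <= (3 / 4 : R) <= 1 by apply/andP; split; lra.
have h4 : 0 <= (1 : R) <= 1 by apply/andP; split; lra.
move/small: h1; move/small: h2; move/small: h3; move/small: h4.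
rewrite !ltr_norml => /andP[a1 b1] /andP[a2 b2] /andP[a3 b3] /andP[a4 b4].
have n1 : `|e1| <= 320 * S by rewrite ler_norml; apply/andP; split; lra.
have n2 : `|e2| <= 320 * S by rewrite ler_norml; apply/andP; split; lra.
have n3 : `|e3| <= 320 * S by rewrite ler_norml; apply/andP; split; lra.
have n4 : `|e4| <= 320 * S by rewrite ler_norml; apply/andP; split; lra.
lra.
Qed.

Lemma poly4_ivt (e1 e2 e3 e4 S : R) : 0 < S ->
  1300 * S <= `|e1| + `|e2| + `|e3| + `|e4| ->
  exists2 sg : R, sg = 1 \/ sg = -1 & forall s, 0 <= s <= S ->
  exists2 th : R, 0 <= th <= 1 &
    e1 * th + e2 * th ^+ 2 + e3 * th ^+ 3 + e4 * th ^+ 4 = sg * s.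
Proof.
move=> S0 /(poly4_large S0)[th1 /andP[th0 th11] hth].
pose ev (x : R) := e1 * x + e2 * x ^+ 2 + e3 * x ^+ 3 + e4 * x ^+ 4.
have [sg hsg hev] : exists2 sg : R, sg = 1 \/ sg = -1 & S <= sg * ev th1.
  have [h|h] := lerP 0 (ev th1).
    by exists 1; [left|move: hth; rewrite -/(ev _) ger0_norm// mul1r].
  by exists (-1); [right|move: hth; rewrite -/(ev _) ltr0_norm// mulN1r].
exists sg => // s /andP[s0 sS].
pose p : {poly R} := sg *: (e1 *: 'X + e2 *: 'X^2 + e3 *: 'X^3 + e4 *: 'X^4)
  - s%:P.
have pE x : p.[x] = sg * ev x - s.
  by rewrite /p /ev hornerD hornerN hornerC hornerZ !hornerD !hornerZ !hornerXn hornerX.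
have [|th /andP[t0 t1]] := @poly_ivt R p 0 th1 th0.
  rewrite !pE; have -> : ev 0 = 0.
    by rewrite /ev !expr0n /= !mulr0 !addr0.
  by rewrite mulr0 sub0r; apply/andP; split; lra.
rewrite rootE pE subr_eq0 => /eqP h; exists th; first by apply/andP; split; lra.
by rewrite -h -/(ev th); case: hsg => ->; ring.
Qed.

Lemma unip_conj (D : 'M[R]_3) t : D^T = D ->
  (unip (- t))^T *m D *m unip (- t) =
  let d01 := D o0 o1 + t * D o0 o0 in
  let d02 := D o0 o2 - t * D o0 o1 - t ^+ 2 / 2 * D o0 o0 in
  let d12 := D o1 o2 - t * (D o1 o1 - D o0 o2) - t ^+ 2 * (3 / 2 * D o0 o1)
             - t ^+ 3 / 2 * D o0 o0 in
  mx3 (D o0 o0) d01 d02 d01 (D o1 o1 + 2 * t * D o0 o1 + t ^+ 2 * D o0 o0) d12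
      d02 d12
      (D o2 o2 - 2 * t * D o1 o2 + t ^+ 2 * (D o1 o1 - D o0 o2)
       + t ^+ 3 * D o0 o1 + t ^+ 4 / 4 * D o0 o0).
Proof.
move=> /matrixP sD.
have := sD o0 o1; have := sD o0 o2; have := sD o1 o2.
rewrite !mxE => s12 s02 s01.
apply/matrixP; apply: ord3_ind; apply: ord3_ind;
  by rewrite !mulmx3 !mxE /= ?s12 ?s02 ?s01; field.
Qed.

End FrameLimits.

(** * Forms approached from several directions *)

Section NonLinear.
Variable R : realType.
Variable U : set_system nat.
Hypothesis UU : UltraFilter U.
Hypothesis Uoo : \oo `<=` U.

Lemma mx3_entries (a b c e f g h i l : R) : let A := mx3 a b c e f g h i l in
  (((A o0 o0 = a) * (A o0 o1 = b) * (A o0 o2 = c)) *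
   ((A o1 o0 = e) * (A o1 o1 = f) * (A o1 o2 = g)) *
   ((A o2 o0 = h) * (A o2 o1 = i) * (A o2 o2 = l)))%type.
Proof. by rewrite /= !mxE. Qed.

Lemma Jb_entries (b : R) :
  (((Jb b o0 o0 = 0) * (Jb b o0 o1 = 0) * (Jb b o0 o2 = 1)) *
   ((Jb b o1 o0 = 0) * (Jb b o1 o1 = 1) * (Jb b o1 o2 = 0)) *
   ((Jb b o2 o0 = 1) * (Jb b o2 o1 = 0) * (Jb b o2 o2 = b)))%type.
Proof. by rewrite /Jb !mxE. Qed.

Lemma ucvg_eq (x y : nat -> R) (l : R) : (forall n, x n = y n) ->
  y @ U --> l -> x @ U --> l.
Proof. by move=> /funext ->. Qed.

Lemma ucvg_mul0 (x y : nat -> R) (a : R) : x @ U --> a -> y @ U --> (0 : R) ->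
  (fun n => x n * y n) @ U --> (0 : R).
Proof. by move=> xa y0; rewrite -[X in _ --> X](mulr0 a); apply: cvgM. Qed.

Lemma ucvg_inv0 (T : nat -> R) : (forall M, 0 < M -> U [set n | M < T n]) ->
  (fun n => (T n)^-1) @ U --> (0 : R).
Proof.
move=> HT; apply/cvgrPdist_lt => e e0.
have ie0 : 0 < e^-1 by rewrite invr_gt0.
apply: filterS (HT _ ie0) => n /= h; rewrite sub0r normrN.
have T0 : 0 < T n by apply: lt_trans h.
by rewrite gtr0_norm ?invr_gt0// -[e]invrK ltf_pV2 ?posrE.
Qed.

Lemma frame_form_line b (z : 'M[R]_3) :
  frame_form b z = frame_form 0 z + b *: ((row o2 z)^T *m row o2 z).
Proof.
have JE : Jb b = Jb 0 + b *: ((delta_mx 0 o2)^T *m (delta_mx 0 o2 : 'rV[R]_3)).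
  apply/matrixP; apply: ord3_ind; apply: ord3_ind;
    by rewrite [RHS]mxE [X in _ + X]mxE [X in _ * X]mxE big_ord1 !Jb_entries
      !mxE /=; ring.
rewrite /frame_form JE mulmxDr mulmxDl -scalemxAr -scalemxAl !mulmxA rowE trmx_mul.
by rewrite !mulmxA.
Qed.

Lemma frame_unit m d (z : 'M[R]_3) : 0 < d -> frame m d z -> z \in unitmx.
Proof. by move=> d0 [dz _]; rewrite unitmxE dz unitfE gt_eqF. Qed.

(* The growth of [Delta o unip(-t)] in [t] is governed by its lowest right entry
   [p(t)], a polynomial of degree at most four; all other entries are
   combinations of derivatives of [p] and vanish in the limit after rescaling
   [t] so that [p] has size one. *)
Lemma nonlinear_limit_step m d (z : 'M[R]_3) (S0 : R) : 0 < m -> 0 < d -> frame m d z ->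
  nonlinear_limit m (- d ^+ 2) (frame_form 0 z) -> 0 < S0 ->
  exists2 sg : R, sg = 1 \/ sg = -1 & forall s, 0 <= s <= S0 ->
  exists z', [/\ frame m d z', nonlinear_limit m (- d ^+ 2) (frame_form 0 z'),
    forall b, gap_form m (- d ^+ 2) (frame_form b z) -> gap_form m (- d ^+ 2) (frame_form b z') &
    gap_form m (- d ^+ 2) (frame_form (sg * s) z')].
Proof.
move=> m0 d0 fz nlz S00; have uz := frame_unit d0 fz.
pose f := frame_form 0 z; pose k := row o2 z; pose iz := invmx z.
have [|S hS Sf] := @near_seq R U UU Uoo (fun S => gap_form m (- d ^+ 2) S /\
    forall b, S <> f + b *: (k^T *m k)) f.
  by move=> e /(nlz k)[S [h1 h2 h3]]; exists S.
(* The perturbation [S n - f] in the coordinates of the frame. *)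
pose Dl n := iz^T *m S n *m iz - Jb 0.
have izf : iz^T *m f *m iz = Jb 0.
  rewrite /f /frame_form !mulmxA -trmx_mul mulmxV// trmx1 mul1mx -mulmxA mulmxV//.
  by rewrite mulmx1.
have hX : mcvg U (fun n => iz^T *m S n *m iz) (Jb 0).
  by rewrite -izf; apply: mcvg_conj => //; apply: mcvg_cst.
have hD i j : (fun n => Dl n i j) @ U --> (0 : R).
  apply: (@ucvg_eq _ (fun n => (iz^T *m S n *m iz) i j - Jb 0 i j)).
    by move=> n; rewrite [LHS]mxE [(- Jb 0) _ _]mxE.
  by rewrite -[X in _ --> X](subrr (Jb 0 i j)); apply: cvgB;
    [exact: hX|exact: cvg_cst].
have sDl n : (Dl n)^T = Dl n.
  have [[sS _ _] _] := hS n.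
  by rewrite /Dl linearB /= sym_conj// sym_Jb.
have JD n : Jb 0 + Dl n = iz^T *m S n *m iz by rewrite /Dl addrC subrK.
have SE n : S n = z^T *m (Jb 0 + Dl n) *m z.
  rewrite JD !mulmxA -trmx_mul mulVmx// trmx1 mul1mx -mulmxA mulVmx//.
  by rewrite mulmx1.
have dJD n : \det (Jb 0 + Dl n) = -1.
  have [[_ dS _] _] := hS n; rewrite JD !det_mulmx det_tr det_inv dS fz.1.
  by field; rewrite gt_eqF.
(* The coefficients of [t] to [t ^+ 4] in the last entry given by [unip_conj]. *)
pose c1 n := - 2 * Dl n o1 o2; pose c2 n := Dl n o1 o1 - Dl n o0 o2.
pose c3 n := Dl n o0 o1; pose c4 n := Dl n o0 o0 / 4.
(* If all four vanish, then with [a = Dl n o1 o1 = Dl n o0 o2] the determinant condition reads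
   [(1 + a) ^+ 3 = 1]. Hence [a = 0] and [S n] lies on the excluded line. *)
have nz n : [|| c1 n != 0, c2 n != 0, c3 n != 0 | c4 n != 0].
  apply: contraT; rewrite !negb_or !negbK => /and4P[/eqP h1 /eqP h2 /eqP h3 /eqP h4].
  have [_ hb] := hS n; exfalso; apply: (hb (Dl n o2 o2)).
  rewrite -frame_form_line SE /frame_form; congr (_ *m _ *m _).
  have := sDl n => /matrixP sD.
  have s12 : Dl n o2 o1 = Dl n o1 o2 by rewrite -[LHS]sD mxE.
  have s02 : Dl n o2 o0 = Dl n o0 o2 by rewrite -[LHS]sD mxE.
  have s01 : Dl n o1 o0 = Dl n o0 o1 by rewrite -[LHS]sD mxE.
  have d12 : Dl n o1 o2 = 0 by rewrite /c1 in h1; lra.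
  have d00 : Dl n o0 o0 = 0 by rewrite /c4 in h4; lra.
  have d02 : Dl n o0 o2 = Dl n o1 o1 by rewrite /c2 in h2; lra.
  have := dJD n; rewrite det3.
  have E i j : (Jb 0 + Dl n) i j = Jb 0 i j + Dl n i j by rewrite mxE.
  rewrite !E s12 s02 s01 d12 d00 d02 [Dl n o0 o1]h3 !Jb_entries => hdet.
  have a0 : Dl n o1 o1 = 0.
    have : Dl n o1 o1 * ((Dl n o1 o1 + 3 / 2) ^+ 2 + 3 / 4) = 0 by lra.
    move/eqP; rewrite mulf_eq0 => /orP[/eqP //|/eqP h].
    by have := sqr_ge0 (Dl n o1 o1 + 3 / 2); lra.
  apply/matrixP; apply: ord3_ind; apply: ord3_ind;
    by rewrite E !Jb_entries ?s12 ?s02 ?s01 ?d12 ?d00 ?d02 ?[Dl n o0 o1]h3 ?a0 ?addr0 ?add0r.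
(* [T n] is the time at which the four monomials have total size [L], the amount that [poly4_ivt]
   needs in order to cover [[0, S0]] up to a sign. *)
pose L := 1300 * S0; have L0 : 0 < L by rewrite /L; lra.
have HT n : exists T : R, 0 < T /\
    `|c1 n| * T + `|c2 n| * T ^+ 2 + `|c3 n| * T ^+ 3 + `|c4 n| * T ^+ 4 = L.
  by have [T h1 h2] := exists_scale L0 (nz n); exists T.
have [T hT] := choice HT.
have c10 : c1 @ U --> (0 : R).
  by rewrite -[X in _ --> X](mulr0 (- 2)); apply: cvgM; [exact: cvg_cst|exact: hD].
have c20 : c2 @ U --> (0 : R).
  by rewrite -[X in _ --> X](subr0 0); apply: cvgB; exact: hD.
have c30 : c3 @ U --> (0 : R) by exact: hD.
have c40 : c4 @ U --> (0 : R).
  by rewrite -[X in _ --> X](mul0r (4^-1)); apply: cvgM; [exact: hD|exact: cvg_cst].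
(* The coefficients tend to zero, so reaching size [L] takes longer and longer. *)
have Tinf M : 0 < M -> U [set n | M < T n].
  move=> M0.
  pose h n := `|c1 n| * M + `|c2 n| * M ^+ 2 + `|c3 n| * M ^+ 3 + `|c4 n| * M ^+ 4.
  have h0 : h @ U --> (0 : R).
    have nc (c : nat -> R) (w : R) : c @ U --> (0 : R) ->
        (fun n => `|c n| * w) @ U --> (0 : R).
      move=> /cvg_norm; rewrite normr0 => c0.
      apply: (ucvg_eq (y := fun n => w * `|c n|)); first by move=> n; rewrite mulrC.
      by apply: (ucvg_mul0 (a := w)) c0; exact: cvg_cst.
    rewrite -[X in _ --> X](addr0 0) -[X in _ --> X + _](addr0 0).
    rewrite -[X in _ --> X + _ + _](addr0 0).
    by apply: cvgD; [apply: cvgD; [apply: cvgD|]|]; apply: nc.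
  have /cvgrPdist_lt /(_ _ L0) := h0; apply: filterS => n /=.
  rewrite sub0r normrN => hn; rewrite ltNge; apply/negP => TM.
  have [T0 TL] := hT n.
  have : L <= h n.
    rewrite -TL /h; have mono j (c : R) : `|c| * T n ^+ j <= `|c| * M ^+ j.
      by rewrite ler_wpM2l// lerXn2r ?nnegrE// ltW.
    have := mono 1%N (c1 n); have := mono 2%N (c2 n).
    have := mono 3%N (c3 n); have := mono 4%N (c4 n).
    by rewrite !expr1; lra.
  by have := ler_norm (h n); lra.
have iT0 : (fun n => (T n)^-1) @ U --> (0 : R) by apply: ucvg_inv0.
have TL n : [/\ `|c1 n * T n| <= L, `|c2 n * T n ^+ 2| <= L,
    `|c3 n * T n ^+ 3| <= L, `|c4 n * T n ^+ 4| <= L &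
    `|c1 n * T n| + `|c2 n * T n ^+ 2| + `|c3 n * T n ^+ 3| +
    `|c4 n * T n ^+ 4| = L].
  have [T0 hL] := hT n.
  have E : `|c1 n * T n| + `|c2 n * T n ^+ 2| + `|c3 n * T n ^+ 3| +
    `|c4 n * T n ^+ 4| = L.
    have nE (c : R) j : `|c * T n ^+ j| = `|c| * T n ^+ j.
      by rewrite normrM (ger0_norm (exprn_ge0 _ (ltW T0))).
    by have := nE (c1 n) 1%N; rewrite expr1 => ->; rewrite !nE.
  have := normr_ge0 (c1 n * T n); have := normr_ge0 (c2 n * T n ^+ 2).
  have := normr_ge0 (c3 n * T n ^+ 3); have := normr_ge0 (c4 n * T n ^+ 4).
  by split; lra.
have [e1 he1] : exists l : R, (fun n => c1 n * T n) @ U --> l.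
  by apply: (@ucvg_bounded _ _ UU _ L) => n; case: (TL n).
have [e2 he2] : exists l : R, (fun n => c2 n * T n ^+ 2) @ U --> l.
  by apply: (@ucvg_bounded _ _ UU _ L) => n; case: (TL n).
have [e3 he3] : exists l : R, (fun n => c3 n * T n ^+ 3) @ U --> l.
  by apply: (@ucvg_bounded _ _ UU _ L) => n; case: (TL n).
have [e4 he4] : exists l : R, (fun n => c4 n * T n ^+ 4) @ U --> l.
  by apply: (@ucvg_bounded _ _ UU _ L) => n; case: (TL n).
have eL : 1300 * S0 <= `|e1| + `|e2| + `|e3| + `|e4|.
  have h : (fun n => `|c1 n * T n| + `|c2 n * T n ^+ 2| + `|c3 n * T n ^+ 3| +
    `|c4 n * T n ^+ 4|) @ U --> `|e1| + `|e2| + `|e3| + `|e4|.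
    by apply: cvgD; [apply: cvgD; [apply: cvgD|]|]; apply: cvg_norm.
  by apply: (ucvg_ge UU h) => n; case: (TL n) => _ _ _ _ ->.
have [sg hsg hth] := poly4_ivt S00 eL.
exists sg => // s /hth[th _ hs].
(* At this time the last entry of the transported perturbation tends to [sg * s]. *)
pose t n := th * T n.
have [g [z' [sgn cz' fz']]] := frame_limit UU m0 d0
  (fun n => frame_unip (t n) fz).
pose A n := unip (t n) *m z *m zmx R (g n).
have zA n : z *m zmx R (g n) = unip (- t n) *m A n.
  by rewrite /A !mulmxA unipD addNr unip0 mul1mx.
have FA b n : frame_form b (A n) = zconj (frame_form b z) (g n).
  by rewrite /A -mulmxA frame_form_unip frame_form_conj.
exists z'; split=> //.
- apply: (nonlinear_limit_lim UU Uoo fz.2 sgn _ nlz).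
  have -> : (fun n => zconj (frame_form 0 z) (g n)) = (fun n => frame_form 0 (A n)).
    by apply/funext => n; rewrite FA.
  exact: frame_form_lim.
(* Parameters already admissible survive, because [unip] preserves each [Jb b]. *)
- move=> b Fb; have Fn n : gap_form m (- d ^+ 2) (frame_form b (A n)).
    by rewrite FA; apply: gap_form_conj.
  by apply: (gap_form_lim UU Fn); apply: frame_form_lim.
have Fn n : gap_form m (- d ^+ 2) (zconj (S n) (g n)).
  by apply: gap_form_conj => //; case: (hS n).
apply: (gap_form_lim UU Fn).
(* [W n] is the form [S n] read in the flowed frame [A n], up to base change; it tends to
   [Jb (sg * s)]. *)
pose W n := (unip (- t n))^T *m (Jb 0 + Dl n) *m unip (- t n).
have -> : (fun n => zconj (S n) (g n)) = (fun n => (A n)^T *m W n *m A n).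
  apply/funext => n; rewrite /zconj SE /W !mulmxA -trmx_mul -mulmxA zA.
  by rewrite trmx_mul !mulmxA.
apply: mcvg_conj => //.
have WE n : W n = Jb 0 + (unip (- t n))^T *m Dl n *m unip (- t n).
  by rewrite /W mulmxDr mulmxDl unip_Jb.
have Tn0 n : T n != 0 by case: (hT n) => h _; rewrite gt_eqF.
have iTj j : (0 < j)%N -> (fun n => (T n)^-1 ^+ j) @ U --> (0 : R).
  case: j => // j _; elim: j => [|j IH].
    by apply: ucvg_eq iT0 => n; rewrite expr1.
  by apply: (ucvg_eq (y := fun n => (T n)^-1 * (T n)^-1 ^+ j.+1));
    [move=> n; rewrite exprS | exact: (ucvg_mul0 iT0 IH)].
(* Every entry but the last is its initial value plus bounded quantities [c_i * T ^+ i] divided by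
   positive powers of [T], and so vanishes in the limit. *)
have k4 (a : R) j : (0 < j)%N ->
    (fun n => a * (c4 n * T n ^+ 4) * (T n)^-1 ^+ j) @ U --> (0 : R).
  by move=> j0; apply: (ucvg_mul0 (a := a * e4) _ (iTj _ j0)); apply: cvgM => //; exact: cvg_cst.
have k3 (a : R) j : (0 < j)%N ->
    (fun n => a * (c3 n * T n ^+ 3) * (T n)^-1 ^+ j) @ U --> (0 : R).
  by move=> j0; apply: (ucvg_mul0 (a := a * e3) _ (iTj _ j0)); apply: cvgM => //; exact: cvg_cst.
have k2 (a : R) j : (0 < j)%N ->
    (fun n => a * (c2 n * T n ^+ 2) * (T n)^-1 ^+ j) @ U --> (0 : R).
  by move=> j0; apply: (ucvg_mul0 (a := a * e2) _ (iTj _ j0)); apply: cvgM => //; exact: cvg_cst.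
have add0 (x y : nat -> R) : x @ U --> (0 : R) -> y @ U --> (0 : R) ->
    (fun n => x n + y n) @ U --> (0 : R).
  by move=> hx hy; rewrite -[X in _ --> X](addr0 0); apply: cvgD.
have l01 : (fun n => Dl n o0 o1 + t n * Dl n o0 o0) @ U --> (0 : R).
  apply: (ucvg_eq (y := fun n => Dl n o0 o1 +
     (4 * th) * (c4 n * T n ^+ 4) * (T n)^-1 ^+ 3)).
    by move=> n; rewrite /c4 /t; have := Tn0 n => h; field.
  by apply: (add0) => //; exact: k4.
have l02 : (fun n => Dl n o0 o2 - t n * Dl n o0 o1 - t n ^+ 2 / 2 * Dl n o0 o0)
    @ U --> (0 : R).
  apply: (ucvg_eq (y := fun n => Dl n o0 o2 +
     - th * (c3 n * T n ^+ 3) * (T n)^-1 ^+ 2 +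
     (- 2 * th ^+ 2) * (c4 n * T n ^+ 4) * (T n)^-1 ^+ 2)).
    by move=> n; rewrite /c3 /c4 /t; have := Tn0 n => h; field.
  by apply: (add0); [apply: (add0); [exact: hD|exact: k3]|exact: k4].
have l11 : (fun n => Dl n o1 o1 + 2 * t n * Dl n o0 o1 + t n ^+ 2 * Dl n o0 o0)
    @ U --> (0 : R).
  apply: (ucvg_eq (y := fun n => Dl n o1 o1 +
     (2 * th) * (c3 n * T n ^+ 3) * (T n)^-1 ^+ 2 +
     (4 * th ^+ 2) * (c4 n * T n ^+ 4) * (T n)^-1 ^+ 2)).
    by move=> n; rewrite /c3 /c4 /t; have := Tn0 n => h; field.
  by apply: (add0); [apply: (add0); [exact: hD|exact: k3]|exact: k4].
have l12 : (fun n => Dl n o1 o2 - t n * (Dl n o1 o1 - Dl n o0 o2)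
     - t n ^+ 2 * (3 / 2 * Dl n o0 o1) - t n ^+ 3 / 2 * Dl n o0 o0)
    @ U --> (0 : R).
  apply: (ucvg_eq (y := fun n => Dl n o1 o2 +
     (- th) * (c2 n * T n ^+ 2) * (T n)^-1 ^+ 1 +
     (- (3 / 2) * th ^+ 2) * (c3 n * T n ^+ 3) * (T n)^-1 ^+ 1 +
     (- 2 * th ^+ 3) * (c4 n * T n ^+ 4) * (T n)^-1 ^+ 1)).
    by move=> n; rewrite /c2 /c3 /c4 /t; have := Tn0 n => h; field.
  apply: (add0); last exact: k4.
  by apply: (add0); [apply: (add0); [exact: hD|exact: k2]|exact: k3].
have l22 : (fun n => Dl n o2 o2 - 2 * t n * Dl n o1 o2
       + t n ^+ 2 * (Dl n o1 o1 - Dl n o0 o2)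
       + t n ^+ 3 * Dl n o0 o1 + t n ^+ 4 / 4 * Dl n o0 o0) @ U --> sg * s.
  rewrite -hs -[X in _ --> X]add0r.
  apply: (ucvg_eq (y := fun n => Dl n o2 o2 + (c1 n * T n * th
    + c2 n * T n ^+ 2 * th ^+ 2 + c3 n * T n ^+ 3 * th ^+ 3
    + c4 n * T n ^+ 4 * th ^+ 4))).
    by move=> n; rewrite /c1 /c2 /c3 /c4 /t; field.
  apply: cvgD; first exact: hD.
  by apply: cvgD; [apply: cvgD; [apply: cvgD|]|]; apply: cvgM => //; exact: cvg_cst.
have WE' n i j : W n i j = Jb 0 i j + ((unip (- t n))^T *m Dl n *m unip (- t n)) i j.
  by rewrite WE mxE.
have fin i j (x : nat -> R) : (forall n,
    ((unip (- t n))^T *m Dl n *m unip (- t n)) i j = x n) ->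
    x @ U --> (0 : R) -> Jb (sg * s) i j = Jb 0 i j ->
    (fun n => W n i j) @ U --> Jb (sg * s) i j.
  move=> hx x0 ->; apply: (ucvg_eq (y := fun n => Jb 0 i j + x n)).
    by move=> n; rewrite WE' hx.
  by rewrite -[X in _ --> X]addr0; apply: cvgD => //; exact: cvg_cst.
apply: ord3_ind; apply: ord3_ind.
- by apply: fin (hD o0 o0) _ => [n|]; rewrite ?unip_conj// ?mx3_entries// !Jb_entries.
- by apply: fin l01 _ => [n|]; rewrite ?unip_conj// ?mx3_entries// !Jb_entries.
- by apply: fin l02 _ => [n|]; rewrite ?unip_conj// ?mx3_entries// !Jb_entries.
- by apply: fin l01 _ => [n|]; rewrite ?unip_conj// ?mx3_entries// !Jb_entries.
- by apply: fin l11 _ => [n|]; rewrite ?unip_conj// ?mx3_entries// !Jb_entries.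
- by apply: fin l12 _ => [n|]; rewrite ?unip_conj// ?mx3_entries// !Jb_entries.
- by apply: fin l02 _ => [n|]; rewrite ?unip_conj// ?mx3_entries// !Jb_entries.
- by apply: fin l12 _ => [n|]; rewrite ?unip_conj// ?mx3_entries// !Jb_entries.
- rewrite Jb_entries; apply: ucvg_eq l22 => n; rewrite WE' unip_conj// mx3_entries.
  by rewrite ?Jb_entries ?mx3_entries add0r.
Qed.

End NonLinear.

(** * Chains, periods and affine maps *)

Section Absurd.
Variable R : realType.

(** Each [nonlinear_limit_step] adjoins the next multiple of [eta] to the admissible parameters, on
    a side that cannot be chosen, and keeps the old ones. After [N + N] steps one side has reached
    [N * eta >= Sg], against [no_chain]. *)
Lemma no_nonlinear_limit (U : set_system nat) m d (z : 'M[R]_3) :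
  UltraFilter U -> \oo `<=` U -> 0 < m -> 0 < d ->
  frame m d z -> ~ nonlinear_limit m (- d ^+ 2) (frame_form 0 z).
Proof.
move=> UU Uoo m0 d0 fz nlz; have [Sg Sg0 [eta eta0 H]] := no_chain m0 d0.
pose N := Num.bound (Sg / eta).
have Seta0 : 0 <= Sg / eta by apply: divr_ge0; apply: ltW.
have SN : Sg <= N%:R * eta.
  by rewrite -ler_pdivrMr// ltW// archi_boundP.
have S00 : 0 < N%:R * eta by lra.
pose good i j z := [/\ frame m d z, nonlinear_limit m (- d ^+ 2) (frame_form 0 z),
  forall a, (a <= i)%N -> gap_form m (- d ^+ 2) (frame_form (a%:R * eta) z) &
  forall a, (a <= j)%N -> gap_form m (- d ^+ 2) (frame_form (- (a%:R * eta)) z)].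
have lt i j z' : good i j z' -> (i < N)%N /\ (j < N)%N.
  move=> [fz' _ Fi Fj]; split; rewrite ltnNge; apply/negP => iN.
    apply: (H _ fz' (fun a => a%:R * eta) N).
    - by rewrite mul0r normr0.
    - by move=> a _; rewrite -mulrBl -natrB// subSnn mul1r gtr0_norm.
    - by rewrite ger0_norm// ltW.
    - by move=> a aN; apply: Fi; apply: leq_trans iN.
  apply: (H _ fz' (fun a => - (a%:R * eta)) N).
  - by rewrite mul0r oppr0 normr0.
  - move=> a _; rewrite -opprD normrN -mulrBl -natrB// subSnn mul1r.
    by rewrite gtr0_norm.
  - by rewrite normrN ger0_norm// ltW.
  - by move=> a aN; apply: Fj; apply: leq_trans iN.
have claim n : exists i j z', (i + j = n)%N /\ good i j z'.
  elim: n => [|n [i [j [z' [ijn gz']]]]].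
    exists 0%N, 0%N, z; split=> //; split=> // a; rewrite leqn0 => /eqP ->.
      by rewrite mul0r; case: fz.
    by rewrite mul0r oppr0; case: fz.
  have [iN jN] := lt _ _ _ gz'; have [fz' nlz' Fi Fj] := gz'.
  have le (a : nat) : (a < N)%N -> 0 <= a.+1%:R * eta <= N%:R * eta.
    by move=> aN; apply/andP; split; [apply: mulr_ge0 => //; apply: ltW|rewrite ler_pM2r// ler_nat].
  have [sg hsg step] := nonlinear_limit_step UU Uoo m0 d0 fz' nlz' S00.
  case: hsg => hsg.
    have [z2 [fz2 nlz2 old new]] := step _ (le _ iN).
    exists i.+1, j, z2; split; first by rewrite addSn ijn.
    split=> // a; last by move=> aj; apply: old; apply: Fj.
    rewrite leq_eqVlt => /orP[/eqP ->|ai]; first by rewrite hsg mul1r in new.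
    by apply: old; apply: Fi.
  have [z2 [fz2 nlz2 old new]] := step _ (le _ jN).
  exists i, j.+1, z2; split; first by rewrite addnS ijn.
  split=> // a; first by move=> aj; apply: old; apply: Fi.
  rewrite leq_eqVlt => /orP[/eqP ->|ai]; first by rewrite hsg mulN1r in new.
  by apply: old; apply: Fj.
have [i [j [z' [ijN /lt[iN jN]]]]] := claim (N + N)%N.
by have := leq_add iN (ltnW jN); rewrite addSn ijN ltnn.
Qed.

(* A nontrivial period would be an integral unipotent matrix, and the square of
   its nilpotent part maps to the isotropic line fixed by [unip t]. *)
Lemma no_period m d (z : 'M[R]_3) (g : 'M[int]_3) (t : R) : 0 < m -> 0 < d ->
  frame m d z -> z *m zmx R g = unip t *m z -> t = 0.
Proof.
move=> m0 d0 fz zg; apply: contrapT => /eqP t0.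
pose G := (g - 1%:M) *m (g - 1%:M).
pose E : 'M[R]_3 := mx3 0 0 (- t ^+ 2) 0 0 0 0 0 0.
have z1 : z *m zmx R (g - 1%:M) = (unip t - 1%:M) *m z.
  have -> : zmx R (g - 1%:M) = zmx R g - 1%:M.
    by rewrite -zmx1; apply/matrixP => i j; rewrite !mxE intrB.
  by rewrite mulmxBr mulmxBl zg mulmx1 mul1mx.
have EE : (unip t - 1%:M) *m (unip t - 1%:M) = E.
  apply/matrixP; apply: ord3_ind; apply: ord3_ind;
    by rewrite !mulmx3 !mxE /= ?mulr0n ?mulr1n; ring.
have zG : z *m zmx R G = E *m z.
  by rewrite /G zmxM mulmxA z1 -mulmxA z1 mulmxA EE.
have [|j zj] := @row2_neq0 R z; first by rewrite fz.1 gt_eqF.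
pose v := G *m delta_mx j (0 : 'I_1).
have zv : z *m zmx R v = cv3 (- t ^+ 2 * z o2 j) 0 0.
  have -> : zmx R v = zmx R G *m delta_mx j 0.
    by rewrite zmxM; congr (_ *m _); exact: map_delta_mx.
  rewrite mulmxA zG -mulmxA -colE; apply/matrixP => a b.
  rewrite [b]ord1 mulmx3 !mxE; move: a.
  by apply: ord3_ind; rewrite /=; ring.
have v0 : v != 0.
  apply/eqP => v0; move: zv; rewrite v0 /zmx map_mx0 mulmx0 => /matrixP /(_ o0 0).
  rewrite !mxE /= => /eqP; rewrite eq_sym mulf_eq0 oppr_eq0 sqrf_eq0.
  by rewrite (negPf t0) (negPf zj).
have [_ [_ _ /(_ v v0)]] := fz.
by rewrite qf_frame_form zv qf_Jb !mxE /= !mulr0 expr0n /= mulr0 !addr0 normr0; lra.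
Qed.

(** In the special orthogonal group of [Jb 0], the stabiliser of the last coordinate is the group
    [unip]. *)
Lemma same_form_unip d (X Y : 'M[R]_3) : 0 < d -> \det X = d -> \det Y = d ->
  frame_form 0 X = frame_form 0 Y -> row o2 X = row o2 Y -> exists t, X = unip t *m Y.
Proof.
move=> d0 dX dY fXY rXY.
have uY : Y \in unitmx by rewrite unitmxE dY unitfE gt_eqF.
pose h := X *m invmx Y.
have XE : X = h *m Y by rewrite /h -mulmxA mulVmx// mulmx1.
have hJ : h^T *m Jb 0 *m h = Jb 0.
  rewrite /h trmx_mul !mulmxA -2!(mulmxA (invmx Y)^T) -/(frame_form 0 X) fXY /frame_form.
  rewrite !mulmxA -trmx_mul mulmxV// trmx1 mul1mx -mulmxA mulmxV//.
  by rewrite mulmx1.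
have dh : \det h = 1 by rewrite det_mulmx det_inv dX dY divff// gt_eqF.
have rh : row o2 h = row o2 1%:M.
  by rewrite /h row_mul rXY -row_mul mulmxV.
clearbody h.
have h20 : h o2 o0 = 0 by move/matrixP: rh => /(_ 0 o0); rewrite !mxE.
have h21 : h o2 o1 = 0 by move/matrixP: rh => /(_ 0 o1); rewrite !mxE.
have h22 : h o2 o2 = 1 by move/matrixP: rh => /(_ 0 o2); rewrite !mxE.
have ent i j : h o0 i * h o2 j + h o1 i * h o1 j + h o2 i * h o0 j = Jb 0 i j.
  have := congr1 (fun M : 'M_3 => M i j) hJ.
  by rewrite /= !mulmx3 !Jb_entries !mxE => <-; ring.
have := ent o0 o0; have := ent o0 o2; have := ent o1 o2; have := ent o2 o2.
rewrite !Jb_entries h20 h21 h22 => e22 e12 e02 e00.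
have h10 : h o1 o0 = 0.
  by apply/eqP; rewrite -sqrf_eq0; apply/eqP; lra.
have h00 : h o0 o0 = 1 by move: e02; rewrite h10; lra.
have h11 : h o1 o1 = 1 by move: dh; rewrite det3 h20 h21 h22 h10 h00; lra.
have h01 : h o0 o1 = - h o1 o2 by move: e12; rewrite h11; lra.
have h02 : h o0 o2 = - (h o1 o2 ^+ 2 / 2) by lra.
exists (h o1 o2); rewrite {1}XE; congr (_ *m _).
by rewrite [LHS]mx3E h20 h21 h22 h10 h00 h11 h01 h02.
Qed.

(** Unless the map is the identity, one of [b1], [b2] is not fixed. As [k >= 1], its iterates move
    away in one direction by at least the first displacement each time, which produces a chain as in
    [no_chain]. *)
Lemma affine_chain m d : 0 < m -> 0 < d ->
  exists2 eta : R, 0 < eta & forall (y : 'M[R]_3), frame m d y ->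
  forall k w b1 b2 : R, 1 <= k <= 1 + eta -> `|w| <= eta ->
    (forall b, gap_form m (- d ^+ 2) (frame_form b y) ->
               gap_form m (- d ^+ 2) (frame_form (k * b + w) y)) ->
    b1 != b2 -> `|b1| <= 1 -> `|b2| <= 1 ->
    gap_form m (- d ^+ 2) (frame_form b1 y) -> gap_form m (- d ^+ 2) (frame_form b2 y) ->
    k = 1 /\ w = 0.
Proof.
move=> m0 d0; have [Sg Sg0 [eta eta0 H]] := no_chain m0 d0.
(* While [|b| < Sg], a step [(k - 1) * b + w] is at most [e * Sg + e = eta]. *)
pose e := eta / (Sg + 1).
have e0 : 0 < e by apply: divr_gt0; lra.
exists e => // y fy k w b1 b2 /andP[k1 ke] we aff b12 n1 n2 F1 F2.
have E : e * (Sg + 1) = eta by rewrite /e; field; rewrite gt_eqF//; lra.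
apply: contrapT => hkw.
have [b0 nb0 [Fb0 hb0]] : exists2 b0 : R, `|b0| <= 1 &
    gap_form m (- d ^+ 2) (frame_form b0 y) /\ k * b0 + w != b0.
  have [h1|h1] := eqVneq (k * b1 + w) b1; last by exists b1.
  have [h2|h2] := eqVneq (k * b2 + w) b2; last by exists b2.
  exfalso; apply: hkw.
  have /eqP : (k - 1) * (b1 - b2) = 0 by lra.
  rewrite mulf_eq0 !subr_eq0 (negPf b12) orbF => /eqP k1'.
  by split=> //; move: h1; rewrite k1'; lra.
pose b i := iter i (fun x => k * x + w) b0.
pose d1 := k * b0 + w - b0.
have d10 : 0 < `|d1| by rewrite normr_gt0 subr_eq0.
have bE i : exists2 s : R, i%:R <= s & b i = b0 + d1 * s.
  elim: i => [|i [s si bs]]; first by exists 0 => //; rewrite mulr0 addr0.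
  exists (1 + k * s).
    have s0 : 0 <= s by apply: le_trans si.
    by rewrite -natr1 addrC lerD2l; apply: le_trans si _; rewrite ler_peMl.
  by rewrite /b iterS -/(b i) bs /d1; ring.
have ex : exists i, Sg <= `|b i|.
  exists (Num.bound ((Sg + 1) / `|d1|)).
  set i := Num.bound _; have [s si ->] := bE i.
  have hi : (Sg + 1) / `|d1| < i%:R by apply: archi_boundP; apply: divr_ge0; lra.
  have s0 : 0 <= s by apply: le_trans si.
  have : (Sg + 1) / `|d1| < s by apply: lt_le_trans si.
  rewrite ltr_pdivrMr// => hs.
  have := lerB_dist (d1 * s) (- b0); rewrite opprK normrN normrM (ger0_norm s0).
  by rewrite [d1 * s + b0]addrC mulrC; lra.
(* Stopping at the first index beyond [Sg] keeps all earlier steps short. *)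
pose N := ex_minn ex.
have [hN minN] : Sg <= `|b N| /\ forall i, Sg <= `|b i| -> (N <= i)%N.
  by rewrite /N; case: ex_minnP.
apply: (H y fy b N) => //.
- move=> i iN; have hi : `|b i| < Sg.
    by rewrite ltNge; apply/negP => /minN; rewrite leqNgt iN.
  have -> : b i.+1 - b i = (k - 1) * b i + w by rewrite /b iterS; ring.
  apply: le_trans (ler_normD _ _) _; rewrite normrM -E.
  have kn : `|k - 1| <= e by rewrite ger0_norm; lra.
  have : `|k - 1| * `|b i| <= e * Sg by rewrite ler_pM// ltW.
  lra.
- move=> i _; elim: i => [//|i IH].
  by rewrite /b iterS; apply: aff.
Qed.

End Absurd.

(** * Forms approached along a line *)

Section Linear.
Variable R : realType.
Variable U : set_system nat.
Hypothesis UU : UltraFilter U.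
Hypothesis Uoo : \oo `<=` U.

Lemma ucvg_eq_near (x y : nat -> R) (a b : R) : x @ U --> a -> y @ U --> b ->
  U [set n | x n = y n] -> a = b.
Proof.
move=> xa yb xy; apply: contrapT => /eqP ab.
have ab0 : 0 < `|a - b| by rewrite normr_gt0 subr_eq0.
have hB : (fun n => x n - y n) @ U --> a - b by apply: cvgB.
move/cvgrPdist_lt: hB => /(_ _ ab0) h.
have [n [/= h1 h2]] := filter_ex (filterI h xy).
by move: h1; rewrite h2 subrr subr0 ltxx.
Qed.

Lemma frame_form_entry b (z : 'M[R]_3) i j :
  frame_form b z i j = frame_form 0 z i j + b * (z o2 i * z o2 j).
Proof.
by rewrite {1}frame_form_line [LHS]mxE [X in _ + X = _]mxE [X in _ * X]mxE big_ord1 !mxE.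
Qed.

Lemma unip_row1 t (X : 'M[R]_3) j : (unip t *m X) o1 j = X o1 j + t * X o2 j.
Proof. by rewrite mulmx3 !mxE /=; ring. Qed.

Lemma natr_dist_ge1 (n l : nat) : n <> l -> 1 <= `|n%:R - l%:R : R|.
Proof.
have lt a b : (a < b)%N -> 1 <= `|a%:R - b%:R : R|.
  move=> ab; have h : a%:R + 1 <= b%:R :> R by rewrite natr1 ler_nat.
  by rewrite distrC ger0_norm; lra.
by case: (ltngtP n l) => // [/lt //|/lt h] _; rewrite distrC.
Qed.

Lemma sqr_ratio_bounds (h eta rn rl : R) : h <= 1 / 8 -> h <= eta / 20 -> 0 < eta ->
  `|rn - 1| <= h -> `|rl - 1| <= h -> rl <= rn ->
  [/\ 0 < rl, rn ^+ 2 <= 2, 1 <= rn ^+ 2 / rl ^+ 2,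
     rn ^+ 2 / rl ^+ 2 <= 2 & rn ^+ 2 / rl ^+ 2 <= 1 + eta].
Proof.
move=> h8 h20 eta0; rewrite !ler_norml => /andP[n1 n2] /andP[l1 l2] ln.
have rl0 : 0 < rl by lra.
have rl20 : 0 < rl ^+ 2 by rewrite exprn_gt0.
have rl2b : 49 / 64 <= rl ^+ 2.
  have : (7 / 8) ^+ 2 <= rl ^+ 2 by rewrite ler_sqr ?nnegrE; lra.
  lra.
have rn2b : rn ^+ 2 <= 81 / 64.
  have : rn ^+ 2 <= (9 / 8) ^+ 2 by rewrite ler_sqr ?nnegrE; lra.
  lra.
split=> //; first lra.
- by rewrite ler_pdivlMr// mul1r ler_sqr ?nnegrE; lra.
- by rewrite ler_pdivrMr//; lra.
rewrite ler_pdivrMr//.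
have h1 : (rn - rl) * (rn + rl) <= (2 * h) * (9 / 4) by apply: ler_pM; lra.
have : eta * (49 / 64) <= eta * rl ^+ 2 by rewrite ler_pM2l.
lra.
Qed.

(** The unipotent orbit of [y] returns, after reduction, near a limit frame [y']. Comparing two
    returns gives an affine map near the identity on the admissible parameters of [y'], which
    [affine_chain] forces to be the identity. The returns then differ by some [unip tau], and
    [no_period] determines [tau], which is too large for two frames near [y']. *)
Lemma no_linear_limit m d (y : 'M[R]_3) (e : R) : 0 < m -> 0 < d -> frame m d y ->
  0 < e ->
  (forall S, gap_form m (- d ^+ 2) S -> nearmx S (frame_form 0 y) e -> exists b, S = frame_form b y) ->
  (forall e', 0 < e' -> exists S, [/\ gap_form m (- d ^+ 2) S, S <> frame_form 0 y &
     nearmx S (frame_form 0 y) e']) -> False.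
Proof.
move=> m0 d0 fy e0 lin noniso; set D := - d ^+ 2 in lin noniso.
have dn0 : d != 0 by rewrite gt_eqF.
have noniso_b e' : 0 < e' -> exists b, [/\ b != 0, `|b| < e' & gap_form m D (frame_form b y)].
  move=> e'0; have [|i yi] := @row2_neq0 R y; first by rewrite fy.1.
  have yi2 : 0 < y o2 i ^+ 2 by rewrite exprn_even_gt0.
  have [|S [FS Sn Sf]] := noniso (Num.min e (e' * y o2 i ^+ 2)).
    by rewrite lt_min e0 mulr_gt0.
  have [|b Sb] := lin S FS.
    by move=> a c; apply: lt_le_trans (Sf a c) _; rewrite ge_min lexx.
  exists b; split; last by rewrite -Sb.
    by apply/eqP => b0; apply: Sn; rewrite Sb b0.
  have := Sf i i; rewrite Sb frame_form_entry addrAC subrr add0r lt_min => /andP[_].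
  by rewrite -expr2 normrM (gtr0_norm yi2) ltr_pM2r.
have [g [y' [sg cz fy']]] := frame_limit UU m0 d0 (fun n => frame_unip n%:R fy).
pose z n := unip n%:R *m y *m zmx R (g n); rewrite -/z in cz.
pose f' := frame_form 0 y'.
have fmz b n : frame_form b (z n) = zconj (frame_form b y) (g n).
  by rewrite /z -mulmxA frame_form_unip frame_form_conj.
have cf : mcvg U (fun n => frame_form 0 (z n)) f' by apply: frame_form_lim.
have zd n : \det (z n) = d.
  by rewrite /z !det_mulmx det_unip det_zmx sg fy.1; ring.
have [k [e1 [e10 hk]]] : exists (k : 'rV[R]_3) (e1 : R), 0 < e1 /\
    forall S, gap_form m D S -> nearmx S f' e1 -> exists b, S = f' + b *: (k^T *m k).
  apply: contrapT => hn; apply: (no_nonlinear_limit UU Uoo m0 d0 fy') => k e1 e10.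
  apply: contrapT => hn2; apply: hn; exists k, e1; split=> // S FS nS.
  apply: contrapT => hn3; apply: hn2; exists S; split=> // b hb.
  by apply: hn3; exists b.
have kE b i j : (f' + b *: (k^T *m k)) i j = f' i j + b * (k 0 i * k 0 j).
  by rewrite [LHS]mxE [X in _ + X = _]mxE [X in _ * X]mxE big_ord1 [k^T _ _]mxE.
have e120 : 0 < e1 / 2 by lra.
(* For small [b], both [frame_form b (z n)] and [frame_form 0 (z n)] lie on the line of [k]. They
   differ by [b] times the square of the last row of [z n], so this row is proportional to [k]. *)
have par n : nearmx (frame_form 0 (z n)) f' (e1 / 2) ->
    exists rho, forall j, z n o2 j = rho * k 0 j.
  move=> nn.
  pose M := `|z n o2 o0| + `|z n o2 o1| + `|z n o2 o2|.
  have zM i : `|z n o2 i| <= M.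
    have := normr_ge0 (z n o2 o0); have := normr_ge0 (z n o2 o1).
    have := normr_ge0 (z n o2 o2); rewrite /M; move: i.
    by apply: ord3_ind; lra.
  have M20 := sqr_ge0 M.
  have e'0 : 0 < e1 / 2 / (M ^+ 2 + 1) by apply: divr_gt0; lra.
  have [b [b0 be Fb]] := noniso_b _ e'0.
  have [||b' hb'] := hk (frame_form b (z n)).
  - by rewrite fmz; apply: gap_form_conj.
  - move=> i j; rewrite frame_form_entry addrAC; apply: le_lt_trans (ler_normD _ _) _.
    have : `|b * (z n o2 i * z n o2 j)| <= e1 / 2.
      rewrite !normrM.
      have h1 : `|z n o2 i| * `|z n o2 j| <= M ^+ 2 by rewrite expr2 ler_pM.
      move: be; rewrite ltr_pdivlMr; last by lra.
      move=> be; have : `|b| * (`|z n o2 i| * `|z n o2 j|) <= `|b| * M ^+ 2.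
        by rewrite ler_wpM2l.
      by have := normr_ge0 b; lra.
    by have := nn i j; lra.
  have [||c hc] := hk (frame_form 0 (z n)).
  - by rewrite fmz; apply: gap_form_conj => //; case: fy.
  - by move=> i j; have := nn i j; lra.
  have E i j : b * (z n o2 i * z n o2 j) = (b' - c) * (k 0 i * k 0 j).
    have h1 := kE b' i j; have h2 := kE c i j.
    by rewrite -hb' frame_form_entry in h1; rewrite -hc in h2; lra.
  have [|i zi] := @row2_neq0 R (z n); first by rewrite zd.
  exists ((b' - c) * k 0 i / (b * z n o2 i)) => j.
  have bz : b * z n o2 i != 0 by rewrite mulf_neq0.
  apply: (mulfI bz); rewrite mulrA [_ * (_ / _)]mulrC divfK// -mulrA E; ring.
have G1 := mcvg_near UU e120 cf.
have [j0 kj0] : exists j0, k 0 j0 != 0.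
  have [n hn] := filter_ex G1; have [rho hrho] := par n hn.
  have [|i zi] := @row2_neq0 R (z n); first by rewrite zd.
  by exists i; apply: contraNneq zi => ki; rewrite hrho ki mulr0.
have par' j : y' o2 j * k 0 j0 = y' o2 j0 * k 0 j.
  apply: (@ucvg_eq_near (fun n => z n o2 j * k 0 j0) (fun n => z n o2 j0 * k 0 j)).
  - by apply: cvgM; [exact: cz|exact: cvg_cst].
  - by apply: cvgM; [exact: cz|exact: cvg_cst].
  by apply: filterS G1 => n /= /par[rho hrho]; rewrite !hrho; ring.
have yj0 : y' o2 j0 != 0.
  have [|i yi] := @row2_neq0 R y'; first by rewrite fy'.1.
  apply: contraNneq yi => h; apply/eqP; apply: (mulIf kj0).
  by rewrite par' h !mul0r.
have kj j : k 0 j = k 0 j0 / y' o2 j0 * y' o2 j.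
  apply: (mulfI yj0); rewrite -par' mulrA [y' o2 j0 * (_ / _)]mulrC divfK//.
  by rewrite mulrC.
pose w := `|y' o2 j0|; have w0 : 0 < w by rewrite normr_gt0.
have w20 : 0 < w ^+ 2 by rewrite exprn_gt0.
have [eta eta0 chain] := affine_chain m0 d0.
pose h' := Num.min (1 / 8) (eta / 20).
have h'0 : 0 < h' by rewrite lt_min; apply/andP; split; lra.
have h'1 : h' <= 1 / 8 by rewrite ge_min lexx.
have h'2 : h' <= eta / 20 by rewrite ge_min lexx orbT.
pose ez := w * h'; pose ef := Num.min (e1 / 2) (h' * w ^+ 2).
have ez0 : 0 < ez by apply: mulr_gt0.
have ef0 : 0 < ef by rewrite lt_min e120 mulr_gt0.
pose G := [set n | nearmx (z n) y' ez /\ nearmx (frame_form 0 (z n)) f' ef].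
have UG : U G by apply: filterI; apply: mcvg_near.
(* A return acts on parameters by the map sending [b] to [c + rho ^+ 2 * b], close to the
   identity. *)
pose data n c rho := [/\ forall b, frame_form b (z n) = frame_form (c + rho ^+ 2 * b) y',
  forall j, z n o2 j = rho * y' o2 j, `|c| <= h' & `|rho - 1| <= h'].
have hdata n : G n -> exists c rho, data n c rho.
  move=> [nz nf].
  have nf1 : nearmx (frame_form 0 (z n)) f' (e1 / 2).
    by move=> i j; apply: lt_le_trans (nf i j) _; rewrite ge_min lexx.
  have [rho0 hrho0] := par n nf1.
  have [||c0 hc0] := hk (frame_form 0 (z n)).
  - by rewrite fmz; apply: gap_form_conj => //; case: fy.
  - by move=> i j; have := nf1 i j; lra.
  pose rho := rho0 * (k 0 j0 / y' o2 j0); pose c := c0 * (k 0 j0 / y' o2 j0) ^+ 2.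
  have zr j : z n o2 j = rho * y' o2 j by rewrite hrho0 kj mulrA.
  have fc i j : frame_form 0 (z n) i j = f' i j + c * (y' o2 i * y' o2 j).
    by rewrite hc0 kE (kj i) (kj j) /c; ring.
  exists c, rho; split=> //.
  - move=> b; apply/matrixP => i j.
    by rewrite [LHS]frame_form_entry fc [RHS]frame_form_entry !zr -/f'; ring.
  - have := nf j0 j0; rewrite fc addrAC subrr add0r -expr2 normrM.
    rewrite lt_min => /andP[_]; rewrite normrX -/w ltr_pM2r//.
    exact: ltW.
  - have := nz o2 j0; rewrite zr -[X in _ * _ - X]mul1r -mulrBl normrM -/w.
    by rewrite /ez mulrC ltr_pM2l// => /ltW.
have key n l cn rn cl rl : data n cn rn -> data l cl rl -> G n -> G l ->
    n <> l -> rl <= rn -> False.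
  move=> [fn zn cnh rnh] [fl zl clh rlh] [nzn _] [nzl _] nl rln.
  have [rl0 rn2b kap1 kap2 kape] := sqr_ratio_bounds h'1 h'2 eta0 rnh rlh rln.
  pose kap := rn ^+ 2 / rl ^+ 2; rewrite -/kap in kap1 kap2 kape.
  have rl20 : 0 < rl ^+ 2 by rewrite exprn_gt0.
  have kapE : kap * rl ^+ 2 = rn ^+ 2 by rewrite /kap divfK// gt_eqF.
  have rn0 : 0 < rn by apply: lt_le_trans rln.
  (* The map of return [n] composed with the inverse of that of return [l]; the order [rl <= rn]
     gives [kap >= 1]. *)
  pose om := cn - kap * cl.
  have ome : `|om| <= eta.
    apply: le_trans (ler_normB _ _) _; rewrite normrM (ger0_norm (_ : 0 <= kap)); last lra.
    have : kap * `|cl| <= 2 * h' by apply: ler_pM => //; lra.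
    lra.
  have Fn b : gap_form m D (frame_form b y) -> gap_form m D (frame_form (cn + rn ^+ 2 * b) y').
    by move=> Fb; rewrite -fn fmz; apply: gap_form_conj.
  have Fl b : gap_form m D (frame_form (cl + rl ^+ 2 * b) y') -> gap_form m D (frame_form b y).
    rewrite -fl fmz => Fb; rewrite -[frame_form b y](zconjK _ (sg l)).
    by apply: gap_form_conj => //; apply: SLzV.
  have aff b : gap_form m D (frame_form b y') -> gap_form m D (frame_form (kap * b + om) y').
    move=> Fb; have : gap_form m D (frame_form ((b - cl) / rl ^+ 2) y).
      apply: Fl; rewrite mulrC divfK ?gt_eqF//.
      by rewrite addrC subrK.
    move/Fn; congr (gap_form _ _ (frame_form _ _)).
    by rewrite /om /kap; field; rewrite gt_eqF.
  (* [be] makes [cn] and [cn + rn ^+ 2 * be] two distinct admissible parameters of [y']. *)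
  have [|be [be0 beh Fbe]] := noniso_b (1 / 4); first lra.
  have [||||||||k1 om0] := chain y' fy' kap om cn (cn + rn ^+ 2 * be).
  - by rewrite kap1.
  - exact: ome.
  - exact: aff.
  - rewrite -subr_eq0 opprD addrA subrr add0r oppr_eq0 mulf_neq0//.
    by rewrite sqrf_eq0 gt_eqF.
  - by apply: le_trans cnh _; apply: le_trans h'1 _; lra.
  - apply: le_trans (ler_normD _ _) _; rewrite normrM (ger0_norm (sqr_ge0 rn)).
    have : rn ^+ 2 * `|be| <= 2 * (1 / 4).
      by apply: ler_pM => //; [exact: sqr_ge0|exact: ltW].
    lra.
  - by have := Fn 0; rewrite mulr0 addr0; apply; case: fy.
  - exact: Fn.
  have rr : rn = rl.
    move: kapE; rewrite k1 mul1r => h; apply/eqP; rewrite eq_le rln andbT.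
    by rewrite -ler_sqr ?nnegrE ?h// ltW.
  have cc : cn = cl by move: om0; rewrite /om k1; lra.
  have [||||tau ht] := @same_form_unip R d (z n) (z l) d0.
  - exact: zd.
  - exact: zd.
  - by rewrite fn fl rr cc.
  - by apply/matrixP => i j; rewrite [LHS]mxE [RHS]mxE zn zl rr.
  (* This period must be trivial, so [tau = n - l] and [|tau| >= 1]. But [unip tau] shifts the
     middle row by [tau] times the last row, while both middle rows are within [ez] of that of
     [y']. *)
  have per : y *m zmx R (g n *m invmx (g l)) = unip (- n%:R + (tau + l%:R)) *m y.
    rewrite zmxM mulmxA.
    have -> : y *m zmx R (g n) = unip (- n%:R) *m z n.
      by rewrite /z !mulmxA unipD addNr unip0 mul1mx.
    rewrite ht /z !mulmxA !unipD -!mulmxA zmxK// mulmx1.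
    by rewrite addrA.
  have := no_period m0 d0 fy per => tau0.
  have tauE : tau = n%:R - l%:R by lra.
  have hz : z n o1 j0 = z l o1 j0 + tau * z l o2 j0 by rewrite {1}ht unip_row1.
  have t1 : 1 <= `|tau|.
    by rewrite tauE; apply: natr_dist_ge1.
  have n1 := nzn o1 j0; have n2 := nzl o1 j0; have n3 := nzl o2 j0.
  have hw : w - ez < `|z l o2 j0|.
    have := lerB_dist (y' o2 j0) (y' o2 j0 - z l o2 j0).
    by rewrite opprB addrCA subrr addr0 distrC -/w; lra.
  have hez : ez <= w / 8 by rewrite /ez; have := ler_wpM2l (ltW w0) h'1; lra.
  have tz : `|tau * z l o2 j0| < 2 * ez.
    have -> : tau * z l o2 j0 = (z n o1 j0 - y' o1 j0) - (z l o1 j0 - y' o1 j0).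
      by rewrite hz; ring.
    by apply: le_lt_trans (ler_normB _ _) _; lra.
  move: tz; rewrite normrM.
  have : 1 * `|z l o2 j0| <= `|tau| * `|z l o2 j0| by rewrite ler_wpM2r.
  lra.
have [n Gn _] := ultra_unbounded UU Uoo 0 UG.
have [l Gl nl] := ultra_unbounded UU Uoo n.+1 UG.
have [cn [rn dn]] := hdata n Gn; have [cl [rl dl]] := hdata l Gl.
have nln : n <> l by move=> h; move: nl; rewrite h ltnn.
have [h|h] := lerP rl rn; first exact: (key n l cn rn cl rl).
by apply: (key l n cl rl cn rn) => //; [move=> hh; apply: nln | exact: ltW].
Qed.

End Linear.

(** * Isolation of forms with a gap, and integral automorphs *)

Section Isolation.
Variable R : realType.

(** The special orthogonal group of [Jb 0] acts transitively on isotropic lines of row vectors. *)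
Lemma isotropic_row (k1 k2 k3 : R) : 2 * k1 * k3 + k2 ^+ 2 = 0 ->
  [|| k1 != 0, k2 != 0 | k3 != 0] ->
  exists (h : 'M[R]_3) (l : R), [/\ h^T *m Jb 0 *m h = Jb 0, \det h = 1,
    l != 0 & [/\ h o2 o0 = l * k1, h o2 o1 = l * k2 & h o2 o2 = l * k3]].
Proof.
move=> kk kn; have [k30|k30] := eqVneq k3 0.
  have k20 : k2 = 0.
    by apply/eqP; rewrite -sqrf_eq0 -kk k30 mulr0 add0r.
  have k10 : k1 != 0 by move: kn; rewrite k20 k30 eqxx /= orbF.
  exists (mx3 0 0 1 0 (-1) 0 1 0 0), k1^-1; split.
  - by apply/matrixP; apply: ord3_ind; apply: ord3_ind; rewrite !mulmx3 !mxE /=; ring.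
  - by rewrite det3 !mxE /=; ring.
  - by rewrite invr_eq0.
  - by rewrite !mx3_entries k20 k30 !mulr0 mulVf.
pose t := k2 / k3.
exists (mx3 1 0 0 (- t) 1 0 (- (t ^+ 2 / 2)) t 1), k3^-1; split.
- by apply/matrixP; apply: ord3_ind; apply: ord3_ind; rewrite !mulmx3 !mxE /=; field.
- by rewrite det3 !mxE /=; ring.
- by rewrite invr_eq0.
- rewrite !mx3_entries mulVf//; split=> //; last by rewrite mulrC.
  have k1E : k1 = - k2 ^+ 2 / (2 * k3).
    have k32 : 2 * k3 != 0 by rewrite mulf_neq0// pnatr_eq0.
    by apply: (mulIf k32); rewrite divfK//; lra.
  by rewrite k1E /t; field.
Qed.

(** By [no_nonlinear_limit], forms accumulating at that of [z] lie on a line [f + b *: (k^T *m k)].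
    The fixed determinant makes [k] isotropic, so another frame [y] of the same form has its last
    row along [k], which is the case excluded by [no_linear_limit]. *)
Lemma frame_isolated (U : set_system nat) m d (z : 'M[R]_3) :
  UltraFilter U -> \oo `<=` U -> 0 < m -> 0 < d -> frame m d z ->
  exists2 e : R, 0 < e & forall S, gap_form m (- d ^+ 2) S ->
    nearmx S (frame_form 0 z) e -> S = frame_form 0 z.
Proof.
move=> UU Uoo m0 d0 fz; apply: contrapT => hiso.
set D := - d ^+ 2 in hiso; pose f := frame_form 0 z.
have noniso e : 0 < e -> exists S, [/\ gap_form m D S, S <> f & nearmx S f e].
  move=> e0; apply: contrapT => hn; apply: hiso; exists e => // S FS nS.
  by apply: contrapT => Sn; apply: hn; exists S.
have [k [e0 [e00 hk]]] : exists (k : 'rV[R]_3) (e : R), 0 < e /\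
    forall S, gap_form m D S -> nearmx S f e -> exists b, S = f + b *: (k^T *m k).
  apply: contrapT => hn; apply: (no_nonlinear_limit UU Uoo m0 d0 fz) => k e e0.
  apply: contrapT => hn2; apply: hn; exists k, e; split=> // S FS nS.
  apply: contrapT => hn3; apply: hn2; exists S; split=> // b hb.
  by apply: hn3; exists b.
have [S [FS Sn Sf]] := noniso e0 e00; have [b hb] := hk S FS Sf.
have uz := frame_unit d0 fz.
pose k' := k *m invmx z.
have kk' : k = k' *m z by rewrite /k' -mulmxA mulVmx// mulmx1.
have b0 : b != 0 by apply/eqP => b0; apply: Sn; rewrite hb b0 scale0r addr0.
have SE : S = z^T *m (Jb 0 + b *: (k'^T *m k')) *m z.
  rewrite hb {1 2}kk' mulmxDr mulmxDl -/(frame_form 0 z) -scalemxAr -scalemxAl.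
  by rewrite trmx_mul !mulmxA.
have dS : \det (Jb 0 + b *: (k'^T *m k')) = -1.
  have [_ dS _] := FS; move: dS; rewrite SE !det_mulmx det_tr fz.1 /D => h.
  have d2 : d ^+ 2 != 0 by rewrite expf_neq0// gt_eqF.
  by apply: (mulIf d2); rewrite mulN1r -h; ring.
pose k1 := k' 0 o0; pose k2 := k' 0 o1; pose k3 := k' 0 o2.
have iso : 2 * k1 * k3 + k2 ^+ 2 = 0.
  have E i j : (Jb 0 + b *: (k'^T *m k')) i j = Jb 0 i j + b * (k' 0 i * k' 0 j).
    by rewrite [LHS]mxE [X in _ + X = _]mxE [X in _ * X]mxE big_ord1 [k'^T _ _]mxE.
  apply: (mulfI b0); rewrite mulr0; move: dS.
  rewrite det3 !E !Jb_entries -/k1 -/k2 -/k3 => h; lra.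
have kn : [|| k1 != 0, k2 != 0 | k3 != 0].
  apply: contraT; rewrite !negb_or !negbK => /and3P[/eqP h1 /eqP h2 /eqP h3].
  exfalso; apply: Sn; rewrite hb kk'.
  have -> : k' = 0.
    apply/matrixP => i j; rewrite [i]ord1 [RHS]mxE; move: j.
    exact: ord3_ind.
  by rewrite mul0mx mulmx0 scaler0 addr0.
have [h [l [hJ dh l0 [r0 r1 r2]]]] := isotropic_row iso kn.
pose y := h *m z.
have fy0 : frame_form 0 y = f.
  by rewrite /frame_form /y trmx_mul !mulmxA -2!(mulmxA z^T) hJ.
have fy : frame m d y.
  by split; [rewrite det_mulmx dh mul1r; case: fz | rewrite fy0; case: fz].
have yk j : y o2 j = l * k 0 j.
  by rewrite kk' [LHS]mulmx3 r0 r1 r2 [in RHS]mulmx3; rewrite -/k1 -/k2 -/k3; ring.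
have line c : f + c *: (k^T *m k) = frame_form (c / l ^+ 2) y.
  apply/matrixP => i j; rewrite frame_form_entry fy0 !yk [LHS]mxE [X in _ + X = _]mxE.
  by rewrite [X in _ + c * X = _]mxE big_ord1 [k^T _ _]mxE; field.
apply: (no_linear_limit UU Uoo m0 d0 fy e00).
  rewrite fy0 => T FT nT; have [c hc] := hk T FT nT.
  by exists (c / l ^+ 2); rewrite hc line.
by rewrite fy0.
Qed.

(** The first row of the identity gives integral relations among [c1], [c2], [c3]. If these are
    independent, the squares of the two entries vanish. Otherwise some relation has [q] and [r]
    nonzero; eliminating [c3] gives an integral row [L] with [L *m s = 0], and [L = 0] is the
    claim. *)
Lemma stabilizer_e1 (c1 c2 c3 : R) (s : 'M[int]_3) : zindep c1 c2 -> zindep c1 c3 ->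
  SLz s -> zconj (diag3 c1 c2 c3) s = diag3 c1 c2 c3 -> s o1 o0 = 0 /\ s o2 o0 = 0.
Proof.
move=> c12 c13 ss hs.
have ent j : c1 * (s o0 o0 * s o0 j)%:~R + c2 * (s o1 o0 * s o1 j)%:~R
    + c3 * (s o2 o0 * s o2 j)%:~R = c1 * (o0 == j)%:R.
  have := congr1 (fun M : 'M[R]_3 => M o0 j) hs.
  rewrite /= /zconj !mulmx3 !mxE /= => h; rewrite !intrM.
  have -> : c1 * (o0 == j)%:R = nth 0 (nth [::]
     [:: [:: c1; 0; 0]; [:: 0; c2; 0]; [:: 0; 0; c3]] 0) j.
    by move: j {h}; apply: ord3_ind; rewrite /= ?mulr1 ?mulr0.
  by rewrite -h; ring.
have [[p [q [r [pqr rel]]]]|nrel] := pselect (exists p q r : int,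
   ~ [/\ p = 0, q = 0 & r = 0] /\
   p%:~R * c1 + q%:~R * c2 + r%:~R * c3 = 0); last first.
  apply: contrapT => hn; apply: nrel.
  exists (s o0 o0 * s o0 o0 - 1), (s o1 o0 * s o1 o0), (s o2 o0 * s o2 o0).
  split.
    move=> [_ /eqP + /eqP]; rewrite !mulf_eq0 !orbb => /eqP h1 /eqP h2.
    exact: hn.
  by have := ent o0; rewrite eqxx /= mulr1 intrB => h; lra.
have r0 : r != 0.
  apply/eqP => r0; have [|p0 q0] := c12 p q.
    by rewrite -rel r0 mul0r addr0.
  exact: pqr.
have q0 : q != 0.
  apply/eqP => q0; have [|p0 r00] := c13 p r.
    by rewrite -rel q0 mul0r addr0.
  exact: pqr.
pose L : 'rV[int]_3 := \row_j nth 0 [:: 0; r * s o1 o0; - (q * s o2 o0)] j.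
have Ls : L *m s = 0.
  apply/matrixP => i j; rewrite mulmx3 !mxE /= mul0r add0r.
  pose X := s o0 o0 * s o0 j - (o0 == j)%:R%:Z.
  have [|_ ->] // := c12 (r * X - p * (s o2 o0 * s o2 j))
     (r * s o1 o0 * s o1 j + - (q * s o2 o0) * s o2 j).
  have := ent j => h.
  have hc3 : r%:~R * c3 = - (p%:~R * c1) - q%:~R * c2 by move: rel; lra.
  have X' : X%:~R = (s o0 o0 * s o0 j)%:~R - (o0 == j)%:R :> R.
    by rewrite /X intrB; congr (_ - _); case: (o0 == j).
  have h3 : r%:~R * (c1 * (s o0 o0 * s o0 j)%:~R + c2 * (s o1 o0 * s o1 j)%:~R) +
     (r%:~R * c3) * (s o2 o0 * s o2 j)%:~R = r%:~R * (c1 * (o0 == j)%:R).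
    by rewrite -h; ring.
  rewrite hc3 in h3.
  rewrite !intrD !intrN !intrM X'.
  move: h3; rewrite !intrM => /eqP; rewrite -subr_eq0 => /eqP h3.
  by rewrite -h3; ring.
have L0 : L = 0.
  have := congr1 (fun M => M *m invmx s) Ls.
  by rewrite -mulmxA mulmxV ?SLz_unit// mulmx1 mul0mx.
move/matrixP: L0 => L0; have := L0 0 o1; have := L0 0 o2.
rewrite !mxE /= => /eqP; rewrite oppr_eq0 mulf_eq0 (negPf q0) => /eqP -> /eqP.
by rewrite mulf_eq0 (negPf r0) => /eqP ->.
Qed.

End Isolation.

(** * Small values of irrational diagonal forms *)

Section Oppenheim.
Variable R : realType.

(** This frame factors [(b y) ^ 2 - (a x) ^ 2] as twice the product of [(b y - a x) / 2] and
    [a x + b y]. *)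
Lemma frame_form_diagonal (a b c : R) :
  frame_form 0 (mx3 (- (a / 2)) (b / 2) 0 0 0 c a b 0) = diag3 (- a ^+ 2) (b ^+ 2) (c ^+ 2).
Proof.
by apply/matrixP; apply: ord3_ind; apply: ord3_ind;
  rewrite /frame_form !mulmx3 !mxE /=; field.
Qed.

Lemma fixed_line (s : 'M[int]_3) : s o1 o0 = 0 -> s o2 o0 = 0 ->
  s *m cv3 1 0 0 = s o0 o0 *: cv3 1 0 0.
Proof.
move=> s10 s20; apply/matrixP => i j; rewrite [j]ord1 mulmx3 !mxE /=.
by move: i; apply: ord3_ind; rewrite ?s10 ?s20 /=; ring.
Qed.

Lemma unip_col_row1 t (x : 'cV[R]_3) : (unip t *m x) o1 0 = x o1 0 + t * x o2 0.
Proof. by rewrite mulmx3 !mxE /=; ring. Qed.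

Lemma zmxZ (p : int) (w : 'cV[int]_3) : zmx R (p *: w) = p%:~R *: zmx R w.
Proof. by apply/matrixP => i j; rewrite !mxE intrM. Qed.

(** By isolation, at returns of the orbit all [zconj q (g n)] coincide, so [g n0 *m invmx (g n)] is
    an automorph of [q] and fixes [e1] up to sign. Hence [unip n] moves the image of [e1] to a
    vector that is, up to sign, [z n *m w] for one fixed [w]: bounded, yet with middle coordinate
    [n * a]. *)
Lemma no_gap (a b c m : R) : 0 < a -> 0 < b -> 0 < c -> 0 < m ->
  zindep (- a ^+ 2) (b ^+ 2) -> zindep (- a ^+ 2) (c ^+ 2) ->
  ~ (forall v : 'cV[int]_3, v != 0 ->
       m <= `|qf (diag3 (- a ^+ 2) (b ^+ 2) (c ^+ 2)) (zmx R v)|).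
Proof.
move=> a0 b0 c0 m0 zab zac gap.
set q := diag3 _ _ _ in gap.
pose g0 : 'M[R]_3 := mx3 (- (a / 2)) (b / 2) 0 0 0 c a b 0.
pose d := a * b * c.
have d0 : 0 < d by rewrite !mulr_gt0.
have fg0 : frame_form 0 g0 = q by apply: frame_form_diagonal.
have fr : frame m d g0.
  split; first by rewrite det3 !mxE /= /d; field.
  by rewrite fg0; split; [exact: sym_diag3|rewrite det_diag3 /d; ring|].
have [U [UU Uoo]] := @ultraFilterLemma nat \oo _.
have [g [z' [sg cz fz']]] := frame_limit UU m0 d0 (fun n => frame_unip n%:R fr).
pose z n := unip n%:R *m g0 *m zmx R (g n); rewrite -/z in cz.
have fz n : frame_form 0 (z n) = zconj q (g n) by rewrite /z -mulmxA frame_form_unip frame_form_conj fg0.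
have [e e0 iso] := frame_isolated UU Uoo m0 d0 fz'.
have cf : mcvg U (fun n => frame_form 0 (z n)) (frame_form 0 z') by apply: frame_form_lim.
pose G := [set n | nearmx (frame_form 0 (z n)) (frame_form 0 z') e /\ nearmx (z n) z' 1].
have UG : U G by apply: filterI; apply: mcvg_near => //; exact: ltr01.
have GE n : G n -> zconj q (g n) = frame_form 0 z'.
  move=> [h _]; rewrite -fz; apply: iso => //; rewrite fz.
  by apply: gap_form_conj => //; rewrite -fg0; case: fr.
have [n0 Gn0] := filter_ex UG.
pose e1 : 'cV[int]_3 := cv3 1 0 0.
pose w := invmx (g n0) *m e1.
pose K := (`|z' o1 o0| + 1) * `|zmx R w o0 0| + (`|z' o1 o1| + 1) * `|zmx R w o1 0|
  + (`|z' o1 o2| + 1) * `|zmx R w o2 0|.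
have bd n : G n -> n%:R * a <= K.
  move=> Gn; pose s := g n0 *m invmx (g n).
  have ss : SLz s by apply: SLzM => //; apply: SLzV.
  have qs : zconj q s = q by rewrite /s zconjM (GE _ Gn0) -(GE _ Gn) zconjK.
  have [s10 s20] := stabilizer_e1 zab zac ss qs.
  pose p := s o0 o0.
  have se : s *m e1 = p *: e1 by apply: fixed_line.
  have p1 : `|p%:~R : R| = 1.
    have : qf (zconj q s) (cv3 1 0 0) = qf q (cv3 1 0 0) by rewrite qs.
    have e1E : (cv3 1 0 0 : 'cV[R]_3) = zmx R e1 by rewrite zmx_cv3.
    rewrite -qf_mul e1E -zmxM se !qf_diag3 !mxE /= !mulr0 !mulr1 expr0n /=.
    rewrite !mulr0 !addr0 => h.
    have a2 : - a ^+ 2 != 0 by rewrite oppr_eq0 expf_neq0// gt_eqF.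
    have p2 : (p%:~R : R) ^+ 2 = 1.
      by apply: (mulfI a2); rewrite h expr1n mulr1.
    by apply/eqP; rewrite -sqrp_eq1// real_normK ?num_real// p2.
  have wn : invmx (g n) *m e1 = p *: w.
    rewrite /w scalemxAr -se /s !mulmxA mulVmx ?SLz_unit// mul1mx.
    by [].
  have zw : z n *m zmx R (p *: w) = unip n%:R *m (g0 *m cv3 1 0 0).
    rewrite -wn zmxM mulmxA /z -(mulmxA (unip _ *m g0)) zmxK// mulmx1 -mulmxA.
    by rewrite zmx_cv3.
  have gE : (unip n%:R *m (g0 *m cv3 1 0 0)) o1 0 = n%:R * a.
    by rewrite unip_col_row1 !mulmx3 !mxE /=; ring.
  have pw : z n *m zmx R (p *: w) = p%:~R *: (z n *m zmx R w).
    by rewrite zmxZ -scalemxAr.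
  have na : `|(z n *m zmx R w) o1 0| = n%:R * a.
    have <- : `|(z n *m zmx R (p *: w)) o1 0| = n%:R * a.
      by rewrite zw gE ger0_norm// mulr_ge0// ltW.
    by rewrite pw [X in _ = `|X|]mxE normrM p1 mul1r.
  rewrite -na; move: Gn.2 (zmx R w) @K => nz x K.
  have zb j : `|z n o1 j * x j 0| <= (`|z' o1 j| + 1) * `|x j 0|.
    rewrite normrM ler_wpM2r//.
    have := ler_distD 0 (z n o1 j) (z' o1 j).
    by have := lerB_dist (z n o1 j) (z' o1 j); have := nz o1 j; lra.
  rewrite mulmx3; apply: le_trans (ler_normD _ _) _; apply: lerD => //.
  by apply: le_trans (ler_normD _ _) _; apply: lerD.
have [n Gn hn] := ultra_unbounded UU Uoo (Num.bound (K / a)) UG.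
have K0 : 0 <= K by rewrite /K !addr_ge0// mulr_ge0// addr_ge0.
have : K / a < n%:R.
  apply: lt_le_trans (_ : (Num.bound (K / a))%:R <= _); last by rewrite ler_nat.
  by apply: archi_boundP; apply: divr_ge0 => //; apply: ltW.
by rewrite ltr_pdivrMr// ltNge bd.
Qed.

Lemma small_positive_values (c1 c2 c3 : R) : c1 < 0 -> 0 < c2 -> 0 < c3 ->
  zindep c1 c2 -> zindep c1 c3 ->
  forall eta, 0 < eta -> exists v : 'cV[int]_3, 0 < qf (diag3 c1 c2 c3) (zmx R v) < eta.
Proof.
move=> c1n c2p c3p c12 c13 eta eta0; apply: contrapT => hn.
have [|m m0 gap] := gap_at_zero c1n c2p c3p eta0 c12 c13.
  by move=> v hv; apply: hn; exists v.
have c1E : c1 = - Num.sqrt (- c1) ^+ 2 by rewrite sqr_sqrtr ?opprK//; lra.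
have c2E : c2 = Num.sqrt c2 ^+ 2 by rewrite sqr_sqrtr// ltW.
have c3E : c3 = Num.sqrt c3 ^+ 2 by rewrite sqr_sqrtr// ltW.
apply: (@no_gap (Num.sqrt (- c1)) (Num.sqrt c2) (Num.sqrt c3) m) => //;
  by rewrite ?sqrtr_gt0 ?oppr_gt0 -?c1E -?c2E -?c3E.
Qed.

(** * From irrational ternary forms to sums of six cubes *)

Lemma irrational_zindep (x : R) : irrational x -> zindep 1 x.
Proof.
move=> irr p q; rewrite mulr1 => h.
have [q0|q0] := eqVneq q 0.
  by move: h; rewrite q0 mul0r addr0 => /eqP; rewrite intr_eq0 => /eqP.
exfalso; apply: irr; exists (- p%:Q / q%:Q) => //.
have qr : (q%:~R : R) != 0 by rewrite intr_eq0.
rewrite rmorphM /= fmorphV rmorphN /= !ratr_int; apply: (mulIf qr).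
by rewrite divfK//; lra.
Qed.

Lemma pair_of_cubes (m t u v : R) : (m + t - u) ^+ 3 + (- t - v) ^+ 3 =
  3 * ((m - (u + v)) * ((m - u + v) / 2 + t) ^+ 2) + (m - (u + v)) ^+ 3 / 4.
Proof. by field. Qed.

Lemma six_cubes (u1 u2 u3 u4 u5 u6 tau eps : R) : irrational (u1 + u2) -> 0 < eps ->
  exists x1 x2 x3 x4 x5 x6 : int,
  `|(x1%:~R - u1) ^+ 3 + (x2%:~R - u2) ^+ 3 + (x3%:~R - u3) ^+ 3
    + (x4%:~R - u4) ^+ 3 + (x5%:~R - u5) ^+ 3 + (x6%:~R - u6) ^+ 3 - tau| < eps.
Proof.
move=> /irrational_zindep irr eps0.
have [k /andP[_ k1]] := int_translate_itv (u1 + u2).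
(* Only [k <= u1 + u2] is known, so subtracting one makes [c1] strictly negative. *)
pose m1 := k - 1; pose c1 : R := m1%:~R - (u1 + u2).
have c1n : c1 < 0 by rewrite /c1 /m1 intrB; lra.
clearbody m1.
(* Of two consecutive integers one works: if [n - s] and [n + 1 - s] were both commensurable with
   [c1], so would be their difference [1], but [c1] is irrational. *)
have pick (s : R) : exists2 n : int, 0 < n%:~R - s & zindep c1 (n%:~R - s).
  have [n /andP[n1 _]] := int_translate_itv (s + 2).
  have n0 : 0 < n%:~R - s by lra.
  have np0 : 0 < (n + 1)%:~R - s by rewrite intrD; lra.
  have [h|h] := pselect (zindep c1 (n%:~R - s)); first by exists n.
  exists (n + 1) => // p q hpq; apply: contrapT => pq.
  apply: h => p' q' hpq'; apply: contrapT => pq'.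
  have q0 : q != 0.
    apply/eqP => q0; apply: pq; split=> //; move/eqP: hpq.
    by rewrite q0 mul0r addr0 mulf_eq0 (lt_eqF c1n) orbF intr_eq0 => /eqP.
  have q'0 : q' != 0.
    apply/eqP => q'0; apply: pq'; split=> //; move/eqP: hpq'.
    by rewrite q'0 mul0r addr0 mulf_eq0 (lt_eqF c1n) orbF intr_eq0 => /eqP.
  have rel : (q * q')%:~R + (p * q' - p' * q)%:~R * c1 = 0.
    move: hpq hpq'; rewrite intrB !intrM intrD => h1 h2.
    have : q'%:~R * (p%:~R * c1 + q%:~R * (n%:~R + 1%:~R - s)) -
      q%:~R * (p'%:~R * c1 + q'%:~R * (n%:~R - s)) = 0 by rewrite h1 h2 !mulr0 subr0.
    by move=> <-; ring.
  have [] := irr (q * q' + (p * q' - p' * q) * m1) (- (p * q' - p' * q)).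
    by rewrite mulr1 -rel /c1 intrD intrN !intrM; ring.
  move=> h /eqP; rewrite oppr_eq0 => /eqP h'; move/eqP: h.
  by rewrite h' mul0r addr0 mulf_eq0 (negPf q0) (negPf q'0).
have [m2 c2p c12] := pick (u3 + u4); have [m3 c3p c13] := pick (u5 + u6).
pose c2 : R := m2%:~R - (u3 + u4); pose c3 : R := m3%:~R - (u5 + u6).
pose K := (c1 ^+ 3 + c2 ^+ 3 + c3 ^+ 3) / 4.
pose xi : 'cV[R]_3 := cv3 ((m1%:~R - u1 + u2) / 2) ((m2%:~R - u3 + u4) / 2)
   ((m3%:~R - u5 + u6) / 2).
have dS : \det (diag3 c1 c2 c3) < 0 by rewrite det_diag3 pmulr_llt0// pmulr_llt0.
have [|t ht] := dense_of_small_values (sym_diag3 c1 c2 c3) dS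
  (small_positive_values c1n c2p c3p c12 c13) xi ((tau - K) / 3) (eps := eps / 3).
  lra.
exists (m1 + t o0 0), (- t o0 0), (m2 + t o1 0), (- t o1 0), (m3 + t o2 0), (- t o2 0).
move: ht; rewrite qf_diag3 !mxE /= => ht.
rewrite !intrD !intrN; set X := (X in `|X| < _).
set Y := (X in `|X| < _) in ht.
have -> : X = 3 * Y.
  have e1 := pair_of_cubes m1%:~R (t o0 0)%:~R u1 u2.
  have e2 := pair_of_cubes m2%:~R (t o1 0)%:~R u3 u4.
  have e3 := pair_of_cubes m3%:~R (t o2 0)%:~R u5 u6.
  by rewrite /X /Y /K /c1 /c2 /c3; lra.
by rewrite normrM (ger0_norm (ler0n _ 3)); lra.
Qed.

(** [a] is half of [(a + b) + (a + c) - (b + c)]; so an irrational shift makes one of the three pair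
    sums irrational. *)
Lemma rational_of_pair_sums (a b c : R) : ~ irrational (a + b) ->
  ~ irrational (a + c) -> ~ irrational (b + c) -> ~ irrational a.
Proof.
move=> /contrapT [p _ hp] /contrapT [q _ hq] /contrapT [r _ hr] irr.
apply: irr; exists ((p + q - r) / 2) => //.
by rewrite rmorphM /= rmorphB rmorphD /= fmorphV /= hp hq hr rmorph_nat; field.
Qed.

End Oppenheim.

Theorem theorem1p2 (R : realType) (s : nat) (hs : (6 <= s)%N) (mu : 'I_s -> R)
    (hmu : irrational (mu (Ordinal (leq_trans (isT : (0 < 6)%N) hs)))) :
  dense (range (shifted_cubes mu)).
Proof.
pose i0 := Ordinal (leq_trans (isT : (0 < 6)%N) hs).
pose i1 := Ordinal (leq_trans (isT : (1 < 6)%N) hs).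
pose i2 := Ordinal (leq_trans (isT : (2 < 6)%N) hs).
pose i3 := Ordinal (leq_trans (isT : (3 < 6)%N) hs).
pose i4 := Ordinal (leq_trans (isT : (4 < 6)%N) hs).
pose i5 := Ordinal (leq_trans (isT : (5 < 6)%N) hs).
pose rest (i : 'I_s) :=
  [&& i != i0, i != i1, i != i2, i != i3, i != i4 & i != i5].
(* All further variables are set to zero, the default value of [nth] below, and contribute the
   constant [K]. *)
pose K := \sum_(i < s | rest i) (0 - mu i) ^+ 3.
have sumE (x0 x1 x2 x3 x4 x5 : int) :
    shifted_cubes mu (fun i : 'I_s => nth 0 [:: x0; x1; x2; x3; x4; x5] i) =
    (x0%:~R - mu i0) ^+ 3 + ((x1%:~R - mu i1) ^+ 3 + ((x2%:~R - mu i2) ^+ 3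
    + ((x3%:~R - mu i3) ^+ 3 + ((x4%:~R - mu i4) ^+ 3
    + ((x5%:~R - mu i5) ^+ 3 + K))))).
  rewrite /shifted_cubes (bigD1 i0)//= (bigD1 i1)//= (bigD1 i2)//=.
  rewrite (bigD1 i3)//= (bigD1 i4)//= (bigD1 i5)//=.
  do 6! congr (_ + _).
  apply: eq_big => [i|i]; first by rewrite /rest -!andbA.
  move=> hrest; congr ((_ - _) ^+ 3).
  rewrite nth_default//= leqNgt; apply/negP => i6; move: hrest.
  by case: i i6 => [[|[|[|[|[|[|//]]]]]] hi] _; rewrite -!val_eqE /= ?andbF.
have approx (tau eps : R) : 0 < eps -> exists x : 'I_s -> int,
    `|shifted_cubes mu x - tau| < eps.
  move=> eps0.
  suff [x0 [x1 [x2 [x3 [x4 [x5 h]]]]]] : exists x0 x1 x2 x3 x4 x5 : int,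
      `|(x0%:~R - mu i0) ^+ 3 + (x1%:~R - mu i1) ^+ 3 + (x2%:~R - mu i2) ^+ 3
      + (x3%:~R - mu i3) ^+ 3 + (x4%:~R - mu i4) ^+ 3 + (x5%:~R - mu i5) ^+ 3
      - (tau - K)| < eps.
    exists (fun i : 'I_s => nth 0 [:: x0; x1; x2; x3; x4; x5] i); rewrite sumE.
    by move: h; congr (`|_| < _); ring.
  (* The variables are reordered so that the pair with irrational sum comes first. *)
  have [h01|h01] := pselect (irrational (mu i0 + mu i1)).
    exact: six_cubes.
  have [h02|h02] := pselect (irrational (mu i0 + mu i2)).
    have [x0 [x2 [x1 [x3 [x4 [x5 h]]]]]] := six_cubes (mu i1) (mu i3) (mu i4)
      (mu i5) (tau - K) h02 eps0.
    exists x0, x1, x2, x3, x4, x5; move: h; congr (`|_| < _); ring.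
  have [h12|h12] := pselect (irrational (mu i1 + mu i2)).
    have [x1 [x2 [x0 [x3 [x4 [x5 h]]]]]] := six_cubes (mu i0) (mu i3) (mu i4)
      (mu i5) (tau - K) h12 eps0.
    exists x0, x1, x2, x3, x4, x5; move: h; congr (`|_| < _); ring.
  by have := rational_of_pair_sums h01 h02 h12.
move=> O [tau Otau] oO.
have /nbhs_ballP[eps /= eps0 hO] : nbhs tau O by apply: open_nbhs_nbhs.
have [x hx] := approx tau eps eps0.
exists (shifted_cubes mu x); split; last by exists x.
by apply: hO; rewrite /ball /= distrC.
Qed.
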